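(* Let $\pi\in S_N$ be a permutation such that $Y_\pi$ is toric, $L(\pi)$ is connected, and at least three boxes of $\operatorname{Ess}(\pi)$ lie in $L(\pi)$. Let $G^\pi$ be the associated connected bipartite graph with parts $U_1,U_2$, and assume that all three-dimensional faces of the edge cone $\sigma_\pi$ are simplicial. Let $I$ be a triple of pairwise distinct first independent sets of $G^\pi$ such that any pair of first independent sets of $I$ forms a two-dimensional face of $\sigma_\pi$. If $I$ does not form a three-dimensional face of $\sigma_\pi$, then, up to interchanging the roles of $U_1$ and $U_2$, the triple $I$ is of the form $(A,A',A'')$ or $(A,A',C)$ with $A=U_1\setminus\{i\}$, $A'=U_1\setminus\{i'\}$, $A''=U_1\setminus\{i''\}$ and $C=C_1\sqcup C_2$ a two-sided first independent set ($C_1\subseteq U_1$, $C_2\subseteq U_2$). Moreover, for triples $I$ of these forms (any two members of which form a two-dimensional face): (1) $(A,A',A'')\notin\mathcal{I}^{(3)}_{G^\pi}$ if and only if there exists a two-sided $C\in\mathcal{I}^{(1)}_{G^\pi}$ with $C_1=U_1\setminus\{i,i',i''\}$. (2) $(A,A',C)\notin\mathcal{I}^{(3)}_{G^\pi}$ if and only if $C_1=\{i,i'\}$ or there exists a two-sided $C'\in\mathcal{I}^{(1)}_{G^\pi}$ with $C'_1\subseteq C_1$ and $C_1\setminus C'_1=\{i,i'\}$.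
   Context: Matrix Schubert varieties. Identify $\pi\in S_N$ with the $N\times N$ permutation matrix with entry $1$ at $(i,j)$ iff $\pi(j)=i$. Let $B_-$, $B_+$ be the groups of invertible lower, resp. upper, triangular $N\times N$ matrices; $\overline{X_\pi}=\overline{B_-\pi B_+}\subseteq\mathbb{C}^{N\times N}$ (Zariski closure). The Rothe diagram is $D(\pi)=\{(\pi(j),i): i<j,\ \pi(i)>\pi(j)\}$, whose elements are called boxes (row index, column index). $\operatorname{dom}(\pi)$ is the connected component of $D(\pi)$ containing $(1,1)$ (empty if $(1,1)\notin D(\pi)$), boxes being connected through common sides. The essential set $\operatorname{Ess}(\pi)$ consists of the south-east corners of the connected components of $D(\pi)$, i.e. boxes $(a,b)\in D(\pi)$ with $(a+1,b),(a,b+1)\notin D(\pi)$. $\operatorname{NW}(\pi)$ is the set of boxes $(a,b)$ for which there is $(c,d)\in D(\pi)$ with $a\le c$, $b\le d$. Put $L(\pi)=\operatorname{NW}(\pi)\setminus\operatorname{dom}(\pi)$. $Y_\pi$ is the projection of $\overline{X_\pi}$ to the coordinates indexed by $L(\pi)$. $(\mathbb{C}^* )^{2N}$ (pairs of invertible diagonal matrices) acts on $Y_\pi$ by $\mathcal{M}\mapsto D_1\mathcal{M}D_2^{-1}$; let $T$ be the quotient by the subgroup acting trivially. $Y_\pi$ is called toric if $\dim T=\dim Y_\pi$. Graph. $G^\pi$ is the bipartite graph with parts $U_1$ (the rows meeting $L(\pi)$, $|U_1|=m$) and $U_2$ (the columns meeting $L(\pi)$, $|U_2|=n$), with an edge joining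 $a\in U_1$ and $b\in U_2$ iff $(a,b)\in L(\pi)$. Independent sets of a connected bipartite graph $G$ with parts $U_1,U_2$. A nonempty set of vertices is independent if it contains no two adjacent vertices; an independent set $A\subsetneq V(G)$ is maximal if no other independent set contains it. An independent set is one-sided if it is contained in $U_1$ or in $U_2$; $A=A_1\sqcup A_2$ is two-sided if $\emptyset\ne A_1\subsetneq U_1$ and $\emptyset\ne A_2\subsetneq U_2$. $N(A)$ is the set of vertices adjacent to some vertex of $A$ and $G[A]$ is the induced subgraph. The associated bipartite subgraph $G\{A\}$ is the spanning subgraph of $G$ whose edges are those of $G[A\sqcup N(A)]\sqcup G[(U_i\setminus A)\sqcup(U_j\setminus N(A))]$ if $A\subseteq U_i$ is one-sided ($\{i,j\}=\{1,2\}$), and those of $G[A_1\sqcup N(A_1)]\sqcup G[A_2\sqcup N(A_2)]$ if $A=A_1\sqcup A_2$ is two-sided. The set $\mathcal{I}^{(1)}_G$ of first independent sets consists of those two-sided maximal independent sets and those one-sided independent sets of the form $U_i\setminus\{u\}$ (with $u\in U_i$) whose associated bipartite subgraph has exactly two connected components (isolated vertices count as components). Edge cone and faces. Let $e_i$ ($i\in U_1$), $f_j$ ($j\in U_2$) be the canonical basis of $\mathbb{Z}^{m+n}$ and $e^i,f^j$ the dual basis; $N=\mathbb{Z}^{m+n}/\langle\sum_i e_i-\sum_j f_j\rangle$ and $M=\mathbb{Z}^{m+n}\cap\langle\sum_i e_i-\sum_j f_j\rangle^{\perp}$ are dual lattices. $\sigma_G^\vee=\operatorname{Cone}(e^i+f^j:(i,j)\in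 E(G))\subseteq M_{\mathbb{Q}}$, and the edge cone $\sigma_G\subseteq N_{\mathbb{Q}}$ is its dual; $\sigma_\pi:=\sigma_{G^\pi}$. For an independent set $A$, $\mathcal{H}_A=\{x\in M_{\mathbb{Q}}:\sum_{v\in A}x_v=\sum_{v\in N(A)}x_v\}$. It is known that $A\mapsto\Pi(A):=$ the primitive generator of the ray of $\sigma_G$ dual to the facet $\mathcal{H}_{A_i}\cap\sigma_G^\vee$ (for $i$ with $A_i=A\cap U_i\neq\emptyset$) is a bijection from $\mathcal{I}^{(1)}_G$ to the extremal ray generators of $\sigma_G$. A $d$-tuple of first independent sets is said to form a $d$-dimensional face if its images under $\Pi$ form a $d$-dimensional face of $\sigma_G$; $\mathcal{I}^{(d)}_{G}$ denotes the set of such $d$-tuples. Equivalently, for a set $S$ of $d$ first independent sets, the spanning subgraph $\bigcap_{A\in S}G\{A\}$ has $d+1$ connected components. A face is simplicial if its extremal ray generators are linearly independent. *)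

(* Defs.v *)
(* The field of complex numbers is R[i], for R : realType. *)
From HB Require Import structures.
From mathcomp Require Import all_boot all_order all_fingroup all_algebra.
From mathcomp Require Import reals complex.
From mathcomp Require Import mpoly.

Set Implicit Arguments.
Unset Strict Implicit.
Unset Printing Implicit Defensive.

Import Order.TTheory GRing.Theory Num.Theory.
Local Open Scope ring_scope.

(** * Rothe diagrams *)

(* Boxes are pairs (row index, column index); indices are 0-based, so that
   the north-west box (1,1) of the usual convention is (0,0) here. *)
Section Diagram.
Variables (N : nat) (pi : 'S_N).
Local Notation box := ('I_N * 'I_N)%type.

Definition D : {set box} :=
  [set p : box | [exists i : 'I_N, exists j : 'I_N,
              [&& (i < j)%N, (pi j < pi i)%N & p == (pi j, i)]]].

Definition side : rel box := fun p q =>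
  ((p.1 == q.1) && ((p.2.+1 == q.2 :> nat) || (q.2.+1 == p.2 :> nat))) ||
  ((p.2 == q.2) && ((p.1.+1 == q.1 :> nat) || (q.1.+1 == p.1 :> nat))).

Definition side_in (B : {set box}) : rel box :=
  fun p q => [&& p \in B, q \in B & side p q].

Definition box_connected (B : {set box}) : Prop :=
  {in B &, forall p q, connect (side_in B) p q}.

Definition dom : {set box} :=
  [set p : box in D | [exists q : box in D, [&& q.1 == 0%N :> nat, q.2 == 0%N :> nat
                                  & connect (side_in D) q p]]].

Definition Ess : {set box} :=
  [set p : box in D | ~~ [exists q : box in D, (q.1 == p.1.+1 :> nat) && (q.2 == p.2)]
             && ~~ [exists q : box in D, (q.1 == p.1) && (q.2 == p.2.+1 :> nat)]].

Definition NW : {set box} :=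
  [set p : box | [exists q : box in D, (p.1 <= q.1)%N && (p.2 <= q.2)%N]].

Definition L : {set box} := NW :\: dom.

End Diagram.

(** * The variety Y_pi *)

Section Variety.
Variables (K : fieldType) (N : nat).
Implicit Types (X Y : 'M[K]_N -> Prop) (M : 'M[K]_N).

Definition peval (p : {mpoly K[N * N]}) M : K := p.@[mxvec M 0].

Definition zariski_closure X : 'M[K]_N -> Prop := fun M =>
  forall p, (forall M', X M' -> peval p M' = 0) -> peval p M = 0.

Definition alg_indep_on Y d (f : 'I_d -> {mpoly K[N * N]}) : Prop :=
  forall P : {mpoly K[d]},
    (forall M, Y M -> P.@[fun k => peval (f k) M] = 0) -> P = 0.

(* Dimension as the transcendence degree over K of the ring of polynomial
   functions on Y; for irreducible Y (as for Y_pi) this ring is a domain with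
   the function field of the closure of Y as its field of fractions. *)
Definition variety_dim Y (d : nat) : Prop :=
  (exists f : 'I_d -> {mpoly K[N * N]}, alg_indep_on Y f) /\
  (forall f : 'I_d.+1 -> {mpoly K[N * N]}, ~ alg_indep_on Y f).

(* A point t of (K^* )^(2N) is the row of the diagonal entries of D_1 followed
   by those of D_2. *)
Definition in_torus n (t : 'rV[K]_n) : Prop := forall k, t 0 k != 0.

Definition torus_act (t : 'rV[K]_(N + N)) M : 'M[K]_N :=
  diag_mx (lsubmx t) *m M *m invmx (diag_mx (rsubmx t)).

(* The homomorphisms of algebraic groups (K^* )^n -> (K^* )^d are the monomial
   maps given by integer matrices. *)
Definition monomial_map n d (W : 'M[int]_(n, d)) (t : 'rV[K]_n) : 'rV[K]_d :=
  \row_k \prod_i t 0 i ^ W i k.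

(* The quotient of (K^* )^(2N) by the subgroup acting trivially on Y is a
   d-dimensional torus: there is a surjective homomorphism onto (K^* )^d whose
   kernel is that subgroup. *)
Definition acting_torus_dim Y (d : nat) : Prop :=
  exists W : 'M[int]_(N + N, d),
    (forall y : 'rV[K]_d, in_torus y ->
       exists2 t : 'rV[K]_(N + N), in_torus t & monomial_map W t = y) /\
    (forall t : 'rV[K]_(N + N), in_torus t ->
       (monomial_map W t = const_mx 1 <-> forall M, Y M -> torus_act t M = M)).

Variable pi : 'S_N.

(* Not perm_mx pi, which has its entries 1 at the (i, pi i). *)
Definition permutation_matrix : 'M[K]_N := \matrix_(i, j) (pi j == i)%:R.

Definition borel_orbit : 'M[K]_N -> Prop := fun M =>
  exists b c : 'M[K]_N,
    [/\ b \in unitmx, is_trig_mx b, c \in unitmx, is_trig_mx c^T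
      & M = b *m permutation_matrix *m c].

(* The coordinate space K^L is realized as the space of matrices supported
   on L, on which torus_act is defined. *)
Definition proj_L M : 'M[K]_N :=
  \matrix_(i, j) (if (i, j) \in L pi then M i j else 0).

Definition Y_var : 'M[K]_N -> Prop := fun M' =>
  exists2 M, zariski_closure borel_orbit M & M' = proj_L M.

End Variety.

Definition toric (R : realType) (N : nat) (pi : 'S_N) : Prop :=
  exists2 d, acting_torus_dim (@Y_var R[i] N pi) d
           & variety_dim (@Y_var R[i] N pi) d.

(** * First independent sets of a bipartite graph *)

Section Bipartite.
Variables (T1 T2 : finType) (E : T1 -> T2 -> bool).
Local Notation V := (T1 + T2)%type.
Implicit Types (A B : {set V}) (s : bool).

(* part true is U_1 and part false is U_2. *)
Definition part s : {set V} := [set v : V | (if v is inl _ then true else false) == s].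

Definition adj : rel V := fun u v =>
  match u, v with
  | inl a, inr b | inr b, inl a => E a b
  | _, _ => false
  end.

Definition nbh A : {set V} := [set v | [exists u in A, adj u v]].

Definition independent A : bool :=
  (A != set0) && [forall u in A, forall v in A, ~~ adj u v].

Definition maximal_independent A : bool :=
  (A \proper [set: V]) && maxset independent A.

Definition one_sided A : bool := [exists s, A \subset part s].

Definition two_sided A : bool :=
  [forall s, (A :&: part s != set0) && (A :&: part s \proper part s)].

Definition induced B : rel V := fun u v => [&& u \in B, v \in B & adj u v].

(* If A is contained in U_i, the complement of A and N(A) is the union of
   U_i minus A and U_j minus N(A). *)
Definition associated A : rel V :=
  if one_sided A
  then relU (induced (A :|: nbh A)) (induced (~: (A :|: nbh A)))
  else let Ai s := A :&: part s in
       relU (induced (Ai true :|: nbh (Ai true)))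
            (induced (Ai false :|: nbh (Ai false))).

Definition first_independent : {set {set V}} :=
  [set A | [&& independent A,
               (two_sided A && maximal_independent A) ||
               [exists s, exists u in part s, A == part s :\ u]
             & n_comp (associated A) [set: V] == 2%N]].

(** * The edge cone *)

(* M_Q is the hyperplane pairing x wvec = 0 of Q^V and N_Q is the quotient of
   Q^V by the line of wvec. Elements of N_Q are handled through representatives
   in Q^V, equality in N_Q being eqN; cones in N_Q are predicates on Q^V that
   are invariant under eqN. *)
Local Notation QV := {ffun V -> rat^o}.
Implicit Types (x y z u : QV) (K F : QV -> Prop).

Definition pairing x y : rat := \sum_v (x v : rat) * y v.

Definition wvec : QV := [ffun v : V => (if v is inl _ then 1 else -1) : rat^o].

Definition inM x : Prop := pairing x wvec = 0.

Definition eqN y z : bool := y - z \in <[wvec]>%VS.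

Definition edge_vec (a : T1) (b : T2) : QV :=
  [ffun v : V => ((v == inl a) || (v == inr b))%:R : rat^o].

Definition dual_edge_cone x : Prop :=
  exists2 c : T1 -> T2 -> rat, (forall a b, 0 <= c a b)
    & x = \sum_a \sum_(b | E a b) c a b *: edge_vec a b.

Definition edge_cone y : Prop :=
  forall x, dual_edge_cone x -> 0 <= pairing x y.

Definition integral y : bool := [forall v, (y v : rat) \is a Num.int].

(* Every element of the lattice N has an integral representative. *)
Definition primitive u : Prop :=
  integral u /\
  forall (k : nat) z, integral z -> eqN u (z *+ k) -> k = 1%N.

Definition prim_gen F u : Prop :=
  primitive u /\ forall y, F y <-> exists2 c : rat, 0 <= c & eqN y (c *: u).

Definition face K F : Prop :=
  exists x, [/\ inM x, forall y, K y -> 0 <= pairing x y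
              & forall y, F y <-> K y /\ pairing x y = 0].

Definition rankN (X : seq QV) : nat :=
  (\dim (<<X>> + <[wvec]>)%VS - \dim <[wvec]>%VS)%N.

Definition cone_dim K (d : nat) : Prop :=
  exists X : seq QV,
    [/\ forall y, y \in X -> K y,
        forall y, K y -> y \in (<<X>> + <[wvec]>)%VS & rankN X = d].

(* The sequences of pairwise distinct primitive generators of extremal rays of
   F are linearly independent in N_Q. *)
Definition simplicial F : Prop :=
  forall X : seq QV,
    (forall u, u \in X -> exists2 rho, face F rho & prim_gen rho u) ->
    pairwise (fun u u' => ~~ eqN u u') X ->
    rankN X = size X.

Definition hyperplane A x : Prop :=
  \sum_(v in A) (x v : rat) = \sum_(v in nbh A) (x v : rat).

(* The ray of the edge cone dual to the facet cut out by hyperplane A. *)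
Definition dual_ray A y : Prop :=
  edge_cone y /\
  forall x, dual_edge_cone x -> hyperplane A x -> pairing x y = 0.

Definition is_Pi A u : Prop :=
  exists2 s, A :&: part s != set0 & prim_gen (dual_ray (A :&: part s)) u.

Definition cone_over (I : {set {set V}}) (P : {set V} -> QV) y : Prop :=
  exists2 c : {set V} -> rat, (forall A, 0 <= c A)
    & eqN y (\sum_(A in I) c A *: P A).

Definition forms_face (d : nat) (I : {set {set V}}) : Prop :=
  [/\ I \subset first_independent, #|I| = d &
      exists P : {set V} -> QV,
        [/\ forall A, A \in I -> is_Pi A (P A),
            face edge_cone (cone_over I P) & cone_dim (cone_over I P) d]].

Definition pairwise_face_triple (I : {set {set V}}) : Prop :=
  [/\ I \subset first_independent, #|I| = 3%N &
      forall A B, A \in I -> B \in I -> A != B -> forms_face 2%N [set A; B]].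

End Bipartite.

Arguments part {T1 T2} s.

(** * The graph G^pi *)

Section GraphOfPermutation.
Variables (N : nat) (pi : 'S_N).

Definition Grow : finType := {a : 'I_N | [exists b, (a, b) \in L pi]}.
Definition Gcol : finType := {b : 'I_N | [exists a, (a, b) \in L pi]}.

Definition Gpi (a : Grow) (b : Gcol) : bool := (val a, val b) \in L pi.

End GraphOfPermutation.

(* Main.v *)
(* The toric hypothesis forces L(pi) to be a translated partition shape. The functions
   x_p, for p in L(pi) \ D(pi), are algebraically independent on Y_pi, while the
   dimension of the torus is at most the rank of the vectors e_a - f_b, (a,b) in
   L(pi) \ D(pi). Hence these vectors are independent, the graph of L(pi) \ D(pi) has no
   cycle, and every box of D(pi) outside dom(pi) has exactly one dot of pi to its
   north-west; by connectedness all boxes of L(pi) have the same one. So the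
   neighbourhoods in G^pi are nested, and each part has two vertices adjacent to the
   whole other part and at least four vertices.

   For such a graph, a triple I of first independent sets whose pairs are faces is a face
   exactly when no vertex becomes isolated in the intersection of the graphs G{A},
   A in I, except by being alone on its side of the cuts of I. Whether u is isolated
   depends only on the members A of I not containing u and, among the two-sided ones,
   which form a chain, only on the smallest. As the pairs are faces, an isolated u is
   therefore missed by all three members, at most one of them is two-sided, and the
   others are part s minus a vertex, with part s opposite to u. The neighbourhood of u
   then provides the two-sided set asked for. *)
Require Import Defs.
From mathcomp Require Import all_boot all_order all_fingroup all_algebra.
From mathcomp Require Import reals complex.
From mathcomp Require Import mpoly.
From mathcomp Require Import lra zify ring.

Set Implicit Arguments.
Unset Strict Implicit.
Unset Printing Implicit Defensive.

Import Order.TTheory GRing.Theory Num.Theory.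
Local Open Scope ring_scope.

(** * Cuts by independent sets *)

Section Graph.
Variables (T1 T2 : finType) (E : T1 -> T2 -> bool).
Local Notation V := (T1 + T2)%type.
Local Notation QV := {ffun V -> rat^o}.
Implicit Types (u v x : V) (A B C : {set V}) (I J : {set {set V}}) (s t : bool).

(** Change the sign of the coordinates of y in N_Q on U_2. The quotient by [wvec] then becomes
    functions on the vertices up to constants, the value of y on an edge becomes a difference of two
    function values, and the ray of A becomes, up to sign, the indicator of one side of its cut.
    Elements vanishing on the edges of the intersection of the graphs G{A} are the functions
    constant along those edges, whereas a combination of rays is constant on each class of vertices
    that no cut separates. Matching the two spaces takes two facts: a class without isolated
    vertices is connected, which is where nestedness enters, and a function constant on the classes
    is a combination of cut indicators, obtained by deleting one cut at a time, chosen so that it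
    splits at most one class. An isolated vertex with a companion in its class destroys the match,
    its own indicator being the extra function. The passage from spans to faces uses only that edge
    values of rays are 0 or 1. *)

Definition part_of v : bool := if v is inl _ then true else false.

Lemma in_part s v : (v \in part s) = (part_of v == s).
Proof. by rewrite inE; case: v. Qed.

Lemma adj_sym u v : adj E u v = adj E v u.
Proof. by case: u => u; case: v => v. Qed.

Lemma adj_side u v : adj E u v -> part_of v = ~~ part_of u.
Proof. by case: u => u; case: v => v. Qed.

Definition nested : Prop := forall u v, part_of u = part_of v ->
  (forall x, adj E u x -> adj E v x) \/ (forall x, adj E v x -> adj E u x).

Definition full v : Prop := forall x, part_of x = ~~ part_of v -> adj E v x.

Definition two_full : Prop := forall s, exists u v,
  [/\ u != v, part_of u = s, part_of v = s, full u & full v].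

(* For an edge uv and a first independent set A, u and v are on the same side of
   the cut when uv is an edge of the associated subgraph G{A}. *)
Definition cut A v : bool := (v \in A) (+) ~~ part_of v.

Definition same_class I u v : bool := [forall A in I, cut A u == cut A v].

Definition inner I u v : bool := adj E u v && same_class I u v.

(* The analogue, for the intersection of the graphs G{A}, of having the least
   possible number of components: a vertex is isolated only if it is alone on its
   side of the cuts. *)
Definition no_isolated I : Prop :=
  forall u v, u != v -> same_class I u v -> exists x, inner I u x.

Lemma same_classP I u v :
  reflect (forall A, A \in I -> cut A u = cut A v) (same_class I u v).
Proof.
apply: (iffP forallP) => [h A AI|h A]; first by apply/eqP; apply: (implyP (h A)).
by apply/implyP => AI; apply/eqP; apply: h.
Qed.

Lemma same_class_refl I u : same_class I u u.
Proof. by apply/same_classP. Qed.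

Lemma same_class_sym I u v : same_class I u v = same_class I v u.
Proof. by apply/same_classP/same_classP => h A /h. Qed.

Lemma same_class_trans I v u x : same_class I u v -> same_class I v x -> same_class I u x.
Proof. by move=> /same_classP h /same_classP h'; apply/same_classP => A AI; rewrite h ?h'. Qed.

Lemma same_classS I J u v : I \subset J -> same_class J u v -> same_class I u v.
Proof. by move=> /subsetP sIJ /same_classP h; apply/same_classP => A /sIJ; exact: h. Qed.

Lemma inner_sym I u v : inner I u v = inner I v u.
Proof. by rewrite /inner adj_sym same_class_sym. Qed.

(** A vertex of X of largest degree works, since the neighbourhoods on one side form a chain under
    inclusion. *)
Lemma nested_dominating (X : {set V}) s : nested -> X != set0 -> X \subset part s ->
  exists2 x0, x0 \in X & forall z x, x \in X -> adj E x z -> adj E x0 z.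
Proof.
move=> nst /set0Pn [a aX] /subsetP Xs.
pose F x := #|[pred z | adj E x z]|.
have [x0 x0X x0max] : exists2 x0, x0 \in X & forall x, x \in X -> (F x <= F x0)%N.
  by case: (arg_maxnP F aX) => x0 x0X h; exists x0.
exists x0 => // z x xX xz.
have /eqP e0 : part_of x0 == s by rewrite -in_part Xs.
have /eqP e1 : part_of x == s by rewrite -in_part Xs.
case: (nst x0 x); [by rewrite e0 e1 | move=> sub | by apply].
have s1 : [pred z | adj E x0 z] \subset [pred z | adj E x z] by apply/subsetP => w /sub.
have [le0 eq0] := subset_leqif_card s1.
have : F x0 == F x by rewrite eqn_leq x0max // andbT.
by rewrite /F eq0 => /subsetP /(_ z xz).
Qed.

(** On each side of the class take a dominating vertex. If z has an inner neighbour y, it is also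
    adjacent to the vertex dominating y; so each dominating vertex is joined by inner edges to the
    whole other side of the class, and the class is connected. *)
Lemma class_const (f : V -> rat) I : nested -> no_isolated I ->
    (forall u v, inner I u v -> f u = f v) ->
  forall u v, same_class I u v -> f u = f v.
Proof.
move=> nst niso fE u v uv.
have [->//|u_v] := eqVneq u v.
have Wn x : same_class I u x -> exists y, inner I x y.
  move=> ux; have [e|xu] := eqVneq x u; first by subst x; exact: niso u_v uv.
  by apply: (niso x u xu); rewrite same_class_sym.
pose X t := [set x | same_class I u x && (part_of x == t)].
have XP t x y : x \in X t -> inner I x y -> y \in X (~~ t).
  rewrite !inE => /andP [ux /eqP xt] /andP [xy sxy].
  by rewrite (same_class_trans ux sxy) (adj_side xy) xt eqxx.
have Xs t : X t \subset part t.
  by apply/subsetP => x; rewrite inE in_part => /andP [].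
have uX : u \in X (part_of u) by rewrite inE same_class_refl eqxx.
have [w uw] := Wn u (same_class_refl _ _).
have wX := XP _ _ _ uX uw.
have dom t : X t != set0 ->
    exists2 x0, x0 \in X t & forall z, z \in X (~~ t) -> inner I z x0.
  move=> X0; have [x0 x0X h] := nested_dominating nst X0 (Xs t).
  exists x0 => // z zX; have := zX; rewrite inE => /andP [uz _].
  have [y zy] := Wn z uz; have := XP _ _ _ zX zy; rewrite negbK => yX.
  rewrite /inner adj_sym (h z y yX) /=; last by rewrite adj_sym; case/andP: zy.
  apply: same_class_trans (_ : same_class I z u) _; first by rewrite same_class_sym.
  by move: x0X; rewrite inE => /andP [].
have [|x0 x0X x0P] := dom (part_of u); first by apply/set0Pn; exists u.
have [|z0 z0X z0P] := dom (~~ part_of u); first by apply/set0Pn; exists w.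
have fx0 t x : x \in X t -> f x = f x0.
  have [-> xX|nt] := eqVneq t (part_of u).
    by rewrite (fE _ _ (z0P x _)) ?negbK // (fE _ _ (x0P z0 z0X)).
  have -> : t = ~~ part_of u by case: (t) nt; case: (part_of u).
  by move=> xX; exact: fE (x0P x xX).
rewrite (fx0 (part_of u) u uX) (fx0 (part_of v) v) //.
by rewrite inE uv eqxx.
Qed.

(** The hypothesis on J says that some A in J splits at most one class of the other cuts. Correcting
    f by a multiple of the indicator of A makes it constant on the classes of [I :\ A], and
    induction applies. *)
Lemma class_span (f : V -> rat) n I : #|I| = n ->
    (forall J, J \subset I -> J != set0 -> exists2 A, A \in J &
       forall u b u' b', cut A u -> ~~ cut A b -> cut A u' -> ~~ cut A b' ->
         same_class (J :\ A) u b -> same_class (J :\ A) u' b' ->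
         same_class (J :\ A) u u') ->
    (forall u v, same_class I u v -> f u = f v) ->
  exists k (c : {set V} -> rat), forall v, f v = k + \sum_(A in I) c A * (cut A v)%:R.
Proof.
elim: n I f => [|n IH] I f cI split fI.
  have I0 : I = set0 by apply/eqP; rewrite -cards_eq0 cI.
  have fc u v : f u = f v by apply: fI; apply/same_classP => A; rewrite I0 inE.
  case: (pickP (mem [set: V])) => [v0 _|V0].
    by exists (f v0), (fun=> 0) => v; rewrite I0 big_set0 addr0 (fc v v0).
  by exists 0, (fun=> 0) => v; have := V0 v; rewrite !inE.
have [|A AI Asplit] := split I (subxx _); first by rewrite -cards_eq0 cI.
have cIA : #|I :\ A| = n by have := cardsD1 A I; rewrite AI cI; case.
have splitA J : J \subset I :\ A -> J != set0 -> exists2 A, A \in J &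
       forall u b u' b', cut A u -> ~~ cut A b -> cut A u' -> ~~ cut A b' ->
         same_class (J :\ A) u b -> same_class (J :\ A) u' b' ->
         same_class (J :\ A) u u'.
  by move=> sJ; apply: split; apply: subset_trans sJ (subsetDl _ _).
have sameI u v : same_class (I :\ A) u v -> cut A u = cut A v -> same_class I u v.
  move=> /same_classP h e; apply/same_classP => B BI.
  by have [->//|nB] := eqVneq B A; apply: h; rewrite !inE nB.
have [[u b] /= /and3P [uA bA ub]|noub] := pickP (fun p : V * V =>
  [&& cut A p.1, ~~ cut A p.2 & same_class (I :\ A) p.1 p.2]).
(* This is the jump of f across A inside the only class that A splits; it is the coefficient of
   A. *)
- pose c0 := f u - f b.
  have [|k [c h]] := IH (I :\ A) (fun v => f v - c0 * (cut A v)%:R) cIA splitA.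
    have key x y : same_class (I :\ A) x y -> cut A x -> ~~ cut A y ->
        f x - c0 = f y.
      move=> xy xA yA; have ux := Asplit _ _ _ _ uA bA xA yA ub xy.
      have -> : f x = f u by symmetry; apply: fI; apply: sameI => //; rewrite uA xA.
      have -> : f y = f b.
        apply: fI; apply: sameI; last by rewrite (negbTE yA) (negbTE bA).
        rewrite same_class_sym; apply: same_class_trans _ xy.
        by apply: same_class_trans _ ux; rewrite same_class_sym.
      by rewrite /c0 opprB addrC subrK.
    move=> x y xy /=; case xA: (cut A x); case yA: (cut A y).
    - by congr (_ - _); apply: fI; apply: sameI; rewrite // xA yA.
    - by rewrite mulr1 mulr0 subr0; apply: key; rewrite ?yA.
    - rewrite mulr1 mulr0 subr0; symmetry; apply: key; rewrite ?xA //.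
      by rewrite same_class_sym.
    - by congr (_ - _); apply: fI; apply: sameI; rewrite // xA yA.
  exists k, (fun B => if B == A then c0 else c B) => v.
  rewrite (big_setD1 A AI) /= eqxx addrCA.
  rewrite (eq_bigr (fun B => c B * (cut B v)%:R)) => [|B]; last first.
    by rewrite !inE => /andP [/negbTE ->].
  by rewrite -h addrC subrK.
- have [|k [c h]] := IH (I :\ A) f cIA splitA.
    move=> x y xy; apply: fI; apply: sameI => //.
    case xA: (cut A x); case yA: (cut A y) => //.
      by have := noub (x, y); rewrite /= xA yA xy.
    by have := noub (y, x); rewrite /= xA yA same_class_sym xy.
  exists k, (fun B => if B == A then 0 else c B) => v.
  rewrite (big_setD1 A AI) /= eqxx mul0r add0r h; congr (_ + _).
  by apply: eq_bigr => B; rewrite !inE => /andP [/negbTE ->].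
Qed.

End Graph.

(** * First independent sets *)

Section FirstIndependent.
Variables (T1 T2 : finType) (E : T1 -> T2 -> bool).
Local Notation V := (T1 + T2)%type.
Local Notation FI := (first_independent E).
Implicit Types (u v x : V) (A B C : {set V}) (I J : {set {set V}}) (s t : bool).

Lemma in_one_sided s w v : (v \in part s :\ w) = (v != w) && (part_of v == s).
Proof. by rewrite !inE; case: v. Qed.

Lemma cut_one_sided s w v : part_of w = s -> cut (part s :\ w) v = (v == w) (+) s.
Proof.
move=> sw; rewrite /cut in_one_sided.
have [->|nvw] := eqVneq v w; first by rewrite sw; case: (s).
by case: (part_of v); case: (s).
Qed.

Lemma first_independentP A : A \in FI -> independent E A /\
  ((two_sided A /\ maxset (independent E) A) \/
   exists s u, part_of u = s /\ A = part s :\ u).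
Proof.
rewrite inE => /and3P [iA /orP [/andP [tA /andP [_ mA]]|oA] _]; split=> //; first by left.
right; case/existsP: oA => s /existsP [u /andP [us /eqP ->]].
by exists s, u; split=> //; apply/eqP; rewrite -in_part.
Qed.

Lemma independent_adj A u v : independent E A -> u \in A -> adj E u v -> v \notin A.
Proof.
move=> /andP [_ /forall_inP h] uA uv; apply/negP => vA.
by move/forall_inP: (h u uA) => /(_ v vA); rewrite uv.
Qed.

(** Independence leaves at most one endpoint in A, and the endpoints lie in opposite parts; the cut
    therefore separates them exactly when neither is in A. *)
Lemma cut_adj A u v : A \in FI -> adj E u v ->
  (cut A u == cut A v) = (u \in A) || (v \in A).
Proof.
move=> /first_independentP [iA _] uv; rewrite /cut (adj_side uv).
have := independent_adj (u := u) (v := v) iA; have := uv.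
by case: (u \in A); case: (v \in A); case: (part_of u) => // h0 /(_ isT h0).
Qed.

Lemma two_sided_mem C s : two_sided C -> exists2 u, u \in C & part_of u = s.
Proof.
move=> /forallP /(_ s) /andP [/set0Pn [u]].
by rewrite inE in_part => /andP [uC /eqP us] _; exists u.
Qed.

Lemma two_sided_notin C s : two_sided C -> exists2 u, u \notin C & part_of u = s.
Proof.
move=> /forallP /(_ s) /andP [_ /properP [_ [u us]]].
rewrite inE us andbT => uC; exists u => //.
by apply/eqP; rewrite -in_part.
Qed.

Lemma two_sided_one_sided_set C s u : two_sided C -> C <> part s :\ u.
Proof.
move=> tC e; have [x xC sx] := two_sided_mem (~~ s) tC.
by move: xC; rewrite e in_one_sided sx; case: (s); rewrite andbF.
Qed.

Lemma first_two_sided C : C \in FI -> two_sided C -> maxset (independent E) C.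
Proof.
move=> /first_independentP [_ [[] //|[s [u [_ e]]]]] tC.
by case: (two_sided_one_sided_set tC e).
Qed.

Lemma maximal_nbr C u : maxset (independent E) C -> u \notin C ->
  exists2 x, x \in C & adj E u x.
Proof.
move=> /maxsetP [iC mC] uC.
have [/existsP [x /andP [xC ux]]|/existsPn h] := boolP [exists x, (x \in C) && adj E u x].
  by exists x.
suff iuC : independent E (u |: C).
  by move: uC; rewrite -(mC _ iuC (subsetUr _ _)) setU11.
apply/andP; split; first by apply/set0Pn; exists u; rewrite setU11.
have nu x : x \in u |: C -> ~~ adj E u x.
  rewrite !inE => /orP [/eqP ->|xC]; last by have := h x; rewrite xC.
  by apply/negP => /adj_side; case: (part_of u).
apply/forall_inP => x xuC; apply/forall_inP => y yuC.
move: xuC; rewrite !inE => /orP [/eqP ->|xC]; first exact: nu.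
move: yuC; rewrite !inE => /orP [/eqP ->|yC]; first by rewrite adj_sym nu // !inE xC orbT.
by apply/negP => /(independent_adj iC xC); rewrite yC.
Qed.

(** A vertex of C' opposite to [part t] and outside C would have a neighbour in C by maximality, and
    that neighbour would also lie in C'. *)
Lemma two_sided_antitone C C' t : independent E C' -> maxset (independent E) C ->
  C :&: part t \subset C' -> C' :&: part (~~ t) \subset C.
Proof.
move=> iC' mC /subsetP sub; apply/subsetP => x; rewrite inE in_part => /andP [xC' /eqP sx].
apply: contraT => xC; have [y yC xy] := maximal_nbr mC xC.
have := independent_adj iC' xC' xy; rewrite sub // inE yC in_part.
by rewrite (adj_side xy) sx negbK eqxx.
Qed.

Lemma maxset_independent C : maxset (independent E) C -> independent E C.
Proof. by case/maxsetP. Qed.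

(** A second full vertex in each part survives the removal of w in [part s :\ w]; four vertices in
    each part ensure that a one-sided triple does not use up the part. *)
Definition ferrers : Prop :=
  [/\ nested E, two_full E & forall s, (3 < #|@part T1 T2 s|)%N].

Hypothesis ferrersE : ferrers.

Let nst : nested E. Proof. by case: ferrersE. Qed.
Let big_part s : (3 < #|@part T1 T2 s|)%N. Proof. by case: ferrersE. Qed.

Lemma full_neq s w : exists u, [/\ u != w, part_of u = s & full E u].
Proof.
case: ferrersE => _ /(_ s) [u [v [uv su sv fu fv]]] _.
by have [e|nu] := eqVneq u w; [exists v; rewrite -e eq_sym | exists u].
Qed.

Lemma full_of_side s : exists2 u, part_of u = s & full E u.
Proof. by case: ferrersE => _ /(_ s) [u [v [uv su sv fu fv]]] _; exists u. Qed.

Lemma full_notin C u : independent E C -> two_sided C -> full E u -> u \notin C.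
Proof.
move=> iC tC fu; have [x xC sx] := two_sided_mem (~~ part_of u) tC.
by apply/negP => /(independent_adj iC) /(_ (fu x sx)); rewrite xC.
Qed.

(** Let x in C and y in C' violate both inclusions. By maximality x has a neighbour in C' and y one
    in C; independence forbids y the first and x the second, so neither neighbourhood contains the
    other, against nestedness. *)
Lemma two_sided_chain C C' t : maxset (independent E) C -> maxset (independent E) C' ->
  (C :&: part t \subset C') \/ (C' :&: part t \subset C).
Proof.
move=> mC mC'.
have [s|/subsetPn [x]] := boolP (C :&: part t \subset C'); first by left.
rewrite inE in_part => /andP [xC /eqP xt] xC'; right; apply/subsetP => y.
rewrite inE in_part => /andP [yC' /eqP yt]; apply: contraT => yC.
have [z zC yz] := maximal_nbr mC yC; have [w wC' xw] := maximal_nbr mC' xC'.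
have iC := maxset_independent mC; have iC' := maxset_independent mC'.
case: (nst (u := x) (v := y)); first by rewrite xt yt.
  by move=> /(_ w xw) /(independent_adj iC' yC'); rewrite wC'.
by move=> /(_ z yz) /(independent_adj iC xC); rewrite zC.
Qed.

(** A vertex outside A sees A by maximality in the two-sided case, and through a full vertex other
    than w when A is [part s :\ w]. *)
Lemma nbh_first A s v : A \in FI -> A :&: part s != set0 -> part_of v = ~~ s ->
  (v \in nbh E (A :&: part s)) = (v \notin A).
Proof.
move=> AF As sv; case/first_independentP: AF => iA kind.
apply/idP/idP => [|vA].
  rewrite inE => /existsP [u]; rewrite inE => /andP [/andP [uA _] uv].
  exact: independent_adj iA uA uv.
suff [x xA vx] : exists2 x, x \in A & adj E v x.
  rewrite inE; apply/existsP; exists x.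
  by rewrite adj_sym vx andbT inE xA in_part (adj_side vx) sv negbK eqxx.
case: kind => [[_ mA]|[t [w [wt e]]]]; first exact: maximal_nbr.
have ts : t = s.
  case/set0Pn: As => z; rewrite e in_setI in_one_sided in_part.
  by move=> /andP [/andP [_ /eqP <-] /eqP <-].
have [u [uw us fu]] := full_neq s w.
exists u; first by rewrite e ts in_one_sided uw us eqxx.
by rewrite adj_sym; apply: fu; rewrite us.
Qed.

Lemma edge_out A : A \in FI -> exists u v, [/\ adj E u v, u \notin A & v \notin A].
Proof.
move=> /first_independentP [iA [[tA _]|[s [w [ws e]]]]].
- have [u us fu] := full_of_side true; have [v vs fv] := full_of_side false.
  exists u, v; split; [by apply: fu; rewrite us | exact: full_notin | exact: full_notin].
- have [u us fu] := full_of_side (~~ s).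
  exists w, u; split; first by rewrite adj_sym; apply: fu; rewrite us negbK.
    by rewrite e in_one_sided eqxx.
  by rewrite e in_one_sided us; case: (s); rewrite andbF.
Qed.

Lemma no_isolated1 A : A \in FI -> no_isolated E [set A].
Proof.
move=> AF u v nuv /same_classP /(_ A (set11 A)) cuv.
suff [x ux uxA] : exists2 x, adj E u x & (u \in A) || (x \in A).
  exists x; rewrite /inner ux /=; apply/same_classP => B /set1P ->.
  by apply/eqP; rewrite cut_adj.
case/first_independentP: AF => iA [[tA mA]|[s [w [ws e]]]].
- have [uA|uA] := boolP (u \in A); last first.
    by have [x xA ux] := maximal_nbr mA uA; exists x; rewrite ?xA.
  have [x xs fx] := full_of_side (~~ part_of u); exists x => //.
  by rewrite adj_sym; apply: fx; rewrite xs negbK.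
- have [x [xw xs fx]] := full_neq (~~ part_of u) w.
  exists x; first by rewrite adj_sym; apply: fx; rewrite xs negbK.
  move: cuv; rewrite e !cut_one_sided // => /addIb cuv.
  have uw : u != w.
    by apply/negP => /eqP uw; move: cuv nuv; rewrite uw eqxx eq_sym => <-.
  by rewrite !in_one_sided uw xw xs; case: (part_of u); case: (s).
Qed.

(** Supplies the hypothesis of [class_span]. A one-sided cut has a single vertex on one of its
    sides, so only the class of that vertex can be split. *)
Lemma first_split J : J \subset FI -> J != set0 -> exists2 A, A \in J &
  forall u b u' b', cut A u -> ~~ cut A b -> cut A u' -> ~~ cut A b' ->
    same_class (J :\ A) u b -> same_class (J :\ A) u' b' -> same_class (J :\ A) u u'.
Proof.
move=> /subsetP JF /set0Pn [A0 A0J].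
have [/existsP [A /andP [AJ ntA]]|/existsPn allt] :=
  boolP [exists A, (A \in J) && ~~ two_sided A].
- exists A => // u b u' b'.
  case/first_independentP: (JF A AJ) => _ [[tA _]|[s [w [ws ->]]]].
    by rewrite tA in ntA.
  rewrite !cut_one_sided //; case: (s) => /=.
  + rewrite !addbT !negbK => _ /eqP -> _ /eqP -> h h'.
    by apply: same_class_trans h _; rewrite same_class_sym.
  + rewrite !addbF => /eqP -> _ /eqP -> _ _ _; exact: same_class_refl.
- have tJ A : A \in J -> two_sided A /\ maxset (independent E) A.
    move=> AJ; have tA : two_sided A by have := allt A; rewrite AJ negbK.
    by split=> //; apply: first_two_sided => //; apply: JF.
  (* When all cuts are two-sided, take A with the smallest trace on U_1. By the chain property and
     its reversal on U_2, the side of A where [cut] is true lies in that of every B, hence in a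
     single class. *)
  case: (arg_minnP (fun A : {set V} => #|A :&: part true|) A0J) => A AJ Amin.
  exists A => // u b u' b' uA _ u'A _ _ _.
  have [tA mA] := tJ A AJ.
  suff cB B v : B \in J -> cut A v -> cut B v.
    by apply/same_classP => B; rewrite in_setD => /andP [_ BJ]; rewrite (cB B u) // (cB B u').
  move=> BJ; have [tB mB] := tJ B BJ.
  have sAB : A :&: part true \subset B.
    case: (two_sided_chain true mA mB) => // sBA.
    have sub : B :&: part true \subset A :&: part true by rewrite subsetI sBA subsetIr.
    have := Amin B BJ; have [le eq] := subset_leqif_card sub => le'.
    have : #|B :&: part true| == #|A :&: part true| by rewrite eqn_leq le le'.
    by rewrite eq => h; apply: subset_trans h (subsetIl _ _).
  have /subsetP sBA := two_sided_antitone (maxset_independent mB) mA sAB.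
  rewrite /cut; case sv: (part_of v) => /=.
    by rewrite !addbF => vA; apply: (subsetP sAB); rewrite inE vA in_part sv.
  rewrite !addbT; apply: contra => vB; apply: sBA.
  by rewrite inE vB in_part sv.
Qed.

Lemma first_span (f : V -> rat) I : I \subset FI -> no_isolated E I ->
    (forall u v, inner E I u v -> f u = f v) ->
  exists k (c : {set V} -> rat), forall v, f v = k + \sum_(A in I) c A * (cut A v)%:R.
Proof.
move=> IF niso fE; apply: (class_span (erefl _)).
  by move=> J JI; apply: first_split; apply: subset_trans JI IF.
exact: class_const niso fE.
Qed.

(* All edges at u lie in G{A} if A contains u, so u would stay isolated without A. *)
Lemma isolated_notin I u v : I \subset FI -> same_class I u v -> u != v ->
    (forall x, ~~ inner E I u x) ->
    (forall A, A \in I -> no_isolated E (I :\ A)) ->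
  forall A, A \in I -> u \notin A.
Proof.
move=> /subsetP IF uv nuv isou niso A AI; apply/negP => uA.
have [x /andP [ux /same_classP h]] :=
  niso A AI u v nuv (same_classS (subsetDl _ _) uv).
have := isou x; rewrite /inner ux /= => /negP []; apply/same_classP => B BI.
have [->|nB] := eqVneq B A; last by apply: h; rewrite !inE nB.
by apply/eqP; rewrite cut_adj ?uA // IF.
Qed.

(** Let the trace of C opposite to u be contained in C'. Without C' an edge from u to some x
    survives; as u is outside C, x is in C and so in C'. The edge then survives C' as well. *)
Lemma isolated_two_sided I u v C C' : I \subset FI -> same_class I u v -> u != v ->
    (forall x, ~~ inner E I u x) ->
    (forall A, A \in I -> no_isolated E (I :\ A)) ->
  C \in I -> C' \in I -> two_sided C -> two_sided C' -> C = C'.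
Proof.
move=> IF uv nuv isou niso CI C'I tC tC'.
have notin := isolated_notin IF uv nuv isou niso.
have IF' := subsetP IF.
have mC := first_two_sided (IF' C CI) tC; have mC' := first_two_sided (IF' C' C'I) tC'.
wlog sub : C C' CI C'I tC tC' mC mC' / C :&: part (~~ part_of u) \subset C'.
  move=> wl; case: (two_sided_chain (~~ part_of u) mC mC') => h; first exact: wl.
  by symmetry; apply: wl.
apply/eqP; apply: contraT => nCC'.
have [x /andP [ux /same_classP h]] :=
  niso C' C'I u v nuv (same_classS (subsetDl _ _) uv).
have := isou x; rewrite /inner ux /= => /negP []; apply/same_classP => B BI.
have [->|nB] := eqVneq B C'; last by apply: h; rewrite !inE nB.
apply/eqP; rewrite cut_adj ?IF' //; apply/orP; right.
apply: (subsetP sub); rewrite inE in_part (adj_side ux) eqxx andbT.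
have /eqP : cut C u = cut C x by apply: h; rewrite !inE nCC'.
by rewrite cut_adj ?IF' // (negbTE (notin C CI)).
Qed.

(** The alternative u = w is excluded: w is alone on its side of the cut, while u shares its class
    with v. *)
Lemma isolated_one_sided I u v s w : same_class I u v -> u != v ->
  part s :\ w \in I -> u \notin part s :\ w -> part_of w = s -> part_of u = ~~ s.
Proof.
move=> /same_classP uv nuv AI uA sw; have := uv _ AI.
rewrite !cut_one_sided // => /addIb e.
have uw : u != w by apply/negP => /eqP uw; move: e nuv; rewrite uw eqxx eq_sym => <-.
by move: uA; rewrite in_one_sided uw; case: (part_of u); case: (s).
Qed.

(** The maximal independent set generated by u: the non-neighbours of u in the opposite part,
    together with the vertices on the side of u whose neighbourhood is contained in that of u. *)
Definition nbr_set u : {set V} :=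
  [set v | if part_of v == part_of u then [forall x, adj E v x ==> adj E u x]
           else ~~ adj E u v].

Lemma nbr_set_part u s : s = ~~ part_of u ->
  nbr_set u :&: part s = [set x | (part_of x == s) && ~~ adj E u x].
Proof.
move=> ->; apply/setP => x; rewrite !inE -/(part_of x).
by case: (part_of x); case: (part_of u); rewrite ?andbF ?andbT.
Qed.

Lemma nbr_set_maximal u s : s = ~~ part_of u ->
  (exists2 x, part_of x = s & ~~ adj E u x) ->
  two_sided (nbr_set u) /\ maximal_independent E (nbr_set u).
Proof.
move=> es [z zs nuz].
have uC : u \in nbr_set u by rewrite inE eqxx; apply/forallP => x; apply/implyP.
have zC : z \in nbr_set u by rewrite inE zs es; case: (part_of u).
have indC : independent E (nbr_set u).
  rewrite /independent; apply/andP; split; first by apply/set0Pn; exists u.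
  apply/forall_inP => x xC; apply/forall_inP => y yC; apply/negP => xy.
  wlog sx : x y xC yC xy / part_of x = part_of u => [wl|].
    have [/eqP sx|nsx] := boolP (part_of x == part_of u); first exact: (wl x y).
    apply: (wl y x) => //; first by rewrite adj_sym.
    by rewrite (adj_side xy); case: (part_of x) nsx; case: (part_of u).
  move: xC; rewrite inE sx eqxx => /forallP /(_ y); rewrite xy /= => uy.
  by move: yC; rewrite inE (adj_side xy) sx uy; case: (part_of u).
have tC : two_sided (nbr_set u).
  apply/forallP => t.
  have [f [_ ft ff]] := full_neq t u.
  have fC : f \notin nbr_set u.
    have [tu|tu] := eqVneq t (part_of u).
      by apply/negP => /(independent_adj indC) /(_ (ff z _)); rewrite zC ft tu zs es => /(_ erefl).
    apply/negP => /(independent_adj indC) /(_ (ff u _)); rewrite uC ft.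
    by move=> h; move: tu h; case: (t); case: (part_of u) => // _ /(_ erefl).
  apply/andP; split.
    apply/set0Pn; have [tu|tu] := eqVneq t (part_of u).
      by exists u; rewrite inE uC in_part tu eqxx.
    by exists z; rewrite inE zC in_part zs es; case: (t) tu; case: (part_of u).
  apply/properP; split; first exact: subsetIr.
  by exists f; rewrite ?in_part ?ft // inE (negbTE fC).
split=> //; apply/andP; split.
  have [y yC _] := two_sided_notin true tC.
  by apply/properP; split; [exact: subsetT | exists y; rewrite ?in_setT].
apply/maxsetP; split=> // B iB sCB; apply/eqP; rewrite eqEsubset sCB andbT.
apply/subsetP => x xB; rewrite inE.
case: eqVneq => [sx|sx]; last first.
  by apply/negP => ux; have := independent_adj iB (subsetP sCB u uC) ux; rewrite xB.
apply/forallP => y; apply/implyP => xy; apply: contraT => nuy.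
have yC : y \in nbr_set u by rewrite inE (adj_side xy) sx; case: (part_of u).
by have := independent_adj iB xB xy; rewrite (subsetP sCB y yC).
Qed.

(** By maximality the vertices of the other part seen by one trace of C are exactly those outside C,
    so both blocks of the associated graph are described by membership in C and its edges are the
    edges meeting C. *)
Lemma associated_two_sided C u v : two_sided C -> maxset (independent E) C ->
  associated E C u v = adj E u v && ((u \in C) || (v \in C)).
Proof.
move=> tC mC; have iC := maxset_independent mC.
have nos : one_sided C = false.
  apply/negbTE; apply/negP => /existsP [s /subsetP sub].
  have [x xC xs] := two_sided_mem (~~ s) tC.
  by have := sub x xC; rewrite in_part xs; case: (s).
have inK s x : (x \in C :&: part s :|: nbh E (C :&: part s)) = ((part_of x == s) == (x \in C)).
  rewrite in_setU in_setI in_part; case: eqVneq => [sx|sx] /=.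
    rewrite andbT; suff -> : x \in nbh E (C :&: part s) = false by rewrite orbF.
    apply/negbTE; apply/negP; rewrite inE => /existsP [y]; rewrite inE in_part.
    by case/andP=> /andP [_ /eqP sy] /adj_side; rewrite sx sy; case: (s).
  rewrite andbF /=; apply/idP/idP => [|xC].
    rewrite inE => /existsP [y]; rewrite inE => /andP [/andP [yC _] yx].
    by rewrite (negbTE (independent_adj iC yC yx)).
  have [|y yC xy] := maximal_nbr (u := x) mC; first by case: (x \in C) xC.
  rewrite inE; apply/existsP; exists y; rewrite inE yC in_part (adj_side xy) adj_sym xy andbT.
  by case: (part_of x) sx; case: (s).
rewrite /associated nos /relU /= /induced !inK.
have [uv|] := boolP (adj E u v); last by rewrite !andbF.
rewrite (adj_side uv) !andbT /=.
have := independent_adj (u := u) (v := v) iC; have := uv.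
by case: (u \in C); case: (v \in C); case: (part_of u) => // h0 /(_ isT h0).
Qed.

(** The condition on two components holds automatically here: the connected components of the
    associated graph are the two sides of the cut. *)
Lemma first_of_maximal C : two_sided C -> maximal_independent E C -> C \in FI.
Proof.
move=> tC mxC; have /andP [_ mC] := mxC; have iC := maxset_independent mC.
rewrite inE iC tC mxC /=.
have sym : ssrbool.symmetric (associated E C).
  by move=> u v; rewrite !associated_two_sided // adj_sym orbC.
have csym := sym_connect_sym sym.
have innerE u v : adj E u v -> (cut C u == cut C v) = (u \in C) || (v \in C).
  move=> uv; rewrite /cut (adj_side uv).
  have := independent_adj (u := u) (v := v) iC; have := uv.
  by case: (u \in C); case: (v \in C); case: (part_of u) => // h0 /(_ isT h0).
have niso : no_isolated E [set C].
  move=> u v _ _; suff [x ux xC] : exists2 x, adj E u x & (u \in C) || (x \in C).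
    exists x; rewrite /inner ux /=; apply/same_classP => B /set1P ->.
    by apply/eqP; rewrite innerE.
  have [uC|uC] := boolP (u \in C); last first.
    by have [x xC ux] := maximal_nbr mC uC; exists x; rewrite ?xC.
  have [x xs fx] := full_of_side (~~ part_of u); exists x => //.
  by rewrite adj_sym; apply: fx; rewrite xs negbK.
have conn u v : connect (associated E C) u v = (cut C u == cut C v).
  apply/idP/eqP => [|cuv].
    move=> uv; have cl : closed (associated E C) [pred x | cut C x == cut C u].
      move=> x y; rewrite associated_two_sided // => /andP [xy]; rewrite -innerE //.
      by move=> /eqP xyC; rewrite !inE xyC.
    by have := closed_connect cl uv; rewrite !inE eqxx => /esym /eqP.
  (* The indicator of the component of u is constant along inner edges, hence on the whole side of
     the cut by [class_const]. *)
  pose f x : rat := (connect (associated E C) u x)%:R.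
  have fE x y : inner E [set C] x y -> f x = f y.
    move=> /andP [xy /same_classP /(_ C (set11 C)) /eqP cxy].
    rewrite /f; congr (_%:R); congr nat_of_bool.
    apply: (same_connect_r csym); apply: connect1.
    by rewrite associated_two_sided // xy -innerE.
  have := class_const nst niso fE (u := u) (v := v).
  rewrite /f connect0; case: connect => // /(_ _) /= h.
  have : (1%:R : rat) = 0%:R by apply: h; apply/same_classP => B /set1P ->.
  by move=> /eqP; rewrite oner_eq0.
have [x xC xs] := two_sided_mem true tC; have [y yC ys] := two_sided_notin true tC.
rewrite (_ : n_comp _ _ = n_comp (associated E C) (closure (associated E C) (pred2 x y))).
  by rewrite n_comp_closure2 // conn /cut xC (negbTE yC) xs ys.
apply: eq_n_comp_r => z; rewrite inE; symmetry; rewrite unfold_in.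
apply/pred0Pn; have [/eqP zx|zx] := boolP (cut C z == cut C x).
  by exists x; rewrite !inE /= conn zx !eqxx.
exists y; rewrite !inE /= eqxx orbT andbT conn.
by move: zx; rewrite /cut xC (negbTE yC) xs ys; case: (_ (+) _).
Qed.

End FirstIndependent.

(** * The edge cone *)

Section Cone.
Variables (T1 T2 : finType) (E : T1 -> T2 -> bool).
Local Notation V := (T1 + T2)%type.
Local Notation QV := {ffun V -> rat^o}.
Local Notation FI := (first_independent E).
Implicit Types (A B C : {set V}) (I J : {set {set V}}) (s t : bool) (y z x : QV).

Lemma eqNP y z : eqN y z <->
  exists k : rat, forall v, (y v : rat) = z v + (if part_of v then k else - k).
Proof.
rewrite /eqN; split.
  move=> /vlineP [k e]; exists k => v.
  have /ffunP /(_ v) := e; rewrite !ffunE => h.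
  have -> : (y v : rat) = z v + (y v - z v) by rewrite addrC subrK.
  by congr (_ + _); rewrite h; case: (v) => w /=; rewrite /GRing.scale /= ?mulr1 ?mulrN1.
move=> [k h]; apply/vlineP; exists k; apply/ffunP => v; rewrite !ffunE h.
by case: (v) => w; rewrite /GRing.scale /= ?mulr1 ?mulrN1 addrAC subrr add0r.
Qed.

Lemma eqN_refl y : eqN y y.
Proof. by rewrite /eqN subrr mem0v. Qed.

Lemma eqN_sym y z : eqN y z = eqN z y.
Proof. by rewrite /eqN -opprB memvN. Qed.

Lemma eqN_trans z y x : eqN y z -> eqN z x -> eqN y x.
Proof. by rewrite /eqN => h h'; rewrite -(subrKA z) memvD. Qed.

Lemma eqND y z y' z' : eqN y z -> eqN y' z' -> eqN (y + y') (z + z').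
Proof. by rewrite /eqN => h h'; rewrite opprD addrACA memvD. Qed.

Lemma eqNZ (c : rat) y z : eqN y z -> eqN (c *: y) (c *: z).
Proof. by rewrite /eqN => h; rewrite -scalerBr memvZ. Qed.

Lemma eqN_sum (K : finType) (P : pred K) (F G : K -> QV) :
  (forall i, P i -> eqN (F i) (G i)) -> eqN (\sum_(i | P i) F i) (\sum_(i | P i) G i).
Proof. by move=> h; rewrite /eqN -sumrB memv_suml. Qed.

Definition edge_val y a b : rat := y (inl a) + y (inr b).

Lemma eqN_edge_val y z a b : eqN y z -> edge_val y a b = edge_val z a b.
Proof. by move=> /eqNP [k h]; rewrite /edge_val !h /= addrACA subrr addr0. Qed.

Lemma edge_valD y z a b : edge_val (y + z) a b = edge_val y a b + edge_val z a b.
Proof. by rewrite /edge_val !ffunE addrACA. Qed.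

Lemma edge_valZ (c : rat) y a b : edge_val (c *: y) a b = c * edge_val y a b.
Proof. by rewrite /edge_val !ffunE mulrDr. Qed.

Lemma edge_val_sum (K : finType) (P : pred K) (F : K -> QV) a b :
  edge_val (\sum_(i | P i) F i) a b = \sum_(i | P i) edge_val (F i) a b.
Proof. by rewrite /edge_val !sum_ffunE -big_split. Qed.

Lemma pairing_edge_vec a b y : pairing (edge_vec a b) y = edge_val y a b.
Proof.
rewrite /pairing /edge_val (bigD1 (inl a)) //= (bigD1 (inr b)) //= big1 => [|v].
  by rewrite addr0 !ffunE !eqxx orbT !mul1r.
by move=> /andP [h1 h2]; rewrite ffunE (negbTE h1) (negbTE h2) mul0r.
Qed.

Lemma pairing_suml (K : finType) (P : pred K) (F : K -> QV) y :
  pairing (\sum_(i | P i) F i) y = \sum_(i | P i) pairing (F i) y.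
Proof.
rewrite /pairing exchange_big /=; apply: eq_bigr => v _.
by rewrite sum_ffunE mulr_suml.
Qed.

Lemma pairingZl (c : rat) x y : pairing (c *: x) y = c * pairing x y.
Proof. by rewrite /pairing mulr_sumr; apply: eq_bigr => v _; rewrite ffunE mulrA. Qed.

Lemma pairingDr x y z : pairing x (y + z) = pairing x y + pairing x z.
Proof. by rewrite /pairing -big_split; apply: eq_bigr => v _; rewrite ffunE mulrDr. Qed.

Lemma pairingZr (c : rat) x y : pairing x (c *: y) = c * pairing x y.
Proof. by rewrite /pairing mulr_sumr; apply: eq_bigr => v _; rewrite ffunE mulrCA. Qed.

Lemma pairing_eqN x y z : inM x -> eqN y z -> pairing x y = pairing x z.
Proof.
move=> xM /vlineP [k e]; have -> : y = z + k *: wvec _ _ by rewrite -e addrC subrK.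
by rewrite pairingDr pairingZr xM mulr0 addr0.
Qed.

Lemma pairing_edge_comb (c : T1 -> T2 -> rat) y :
  pairing (\sum_a \sum_(b | E a b) c a b *: edge_vec a b) y =
  \sum_a \sum_(b | E a b) c a b * edge_val y a b.
Proof.
rewrite pairing_suml; apply: eq_bigr => a _; rewrite pairing_suml.
by apply: eq_bigr => b _; rewrite pairingZl pairing_edge_vec.
Qed.

Lemma edge_val_wvec a b : edge_val (wvec T1 T2) a b = 0.
Proof. by rewrite /edge_val !ffunE subrr. Qed.

Lemma dual_edge_cone_inM x : dual_edge_cone E x -> inM x.
Proof.
case=> c _ ->; rewrite /inM pairing_edge_comb big1 // => a _.
by rewrite big1 // => b _; rewrite edge_val_wvec mulr0.
Qed.

Lemma edge_vec_dual a b : E a b -> dual_edge_cone E (edge_vec a b).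
Proof.
move=> ab; exists (fun a' b' => ((a' == a) && (b' == b))%:R) => [*|]; first exact: ler0n.
rewrite (bigD1 a) //= (bigD1 b) //= !eqxx scale1r big1 => [|b' /andP [_ /negbTE ->]].
  rewrite addr0 big1 ?addr0 // => a' /negbTE h.
  by rewrite big1 // => b' _; rewrite h scale0r.
by rewrite scale0r.
Qed.

Lemma edge_coneP y : edge_cone E y <-> forall a b, E a b -> 0 <= edge_val y a b.
Proof.
split=> [h a b ab|h x [c c0 ->]].
  by rewrite -pairing_edge_vec; apply: h; apply: edge_vec_dual.
rewrite pairing_edge_comb; apply: sumr_ge0 => a _; apply: sumr_ge0 => b ab.
by rewrite mulr_ge0 ?h.
Qed.

(** The signs turn sums over an edge into differences of [cut]. For independent A the edge value is
    0 on edges of G{A} and 1 on the others. *)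
Definition ray A : QV :=
  [ffun v => (if part_of v then - (cut A v)%:R else (cut A v)%:R) : rat^o].

Lemma edge_val_ray A a b :
  edge_val (ray A) a b = (cut A (inr b))%:R - (cut A (inl a))%:R.
Proof. by rewrite /edge_val !ffunE addrC. Qed.

Lemma edge_val_ray_first A a b : independent E A -> E a b ->
  edge_val (ray A) a b = ((inl a \notin A) && (inr b \notin A))%:R.
Proof.
move=> iA ab; rewrite edge_val_ray /cut /= addbF addbT.
have := independent_adj (u := inl a) (v := inr b) iA.
case: (_ \in A) => /= [/(_ isT ab) -> | _]; first by rewrite subrr.
by rewrite subr0.
Qed.

Lemma edge_val_ray_ge0 A a b : independent E A -> E a b -> 0 <= edge_val (ray A) a b.
Proof. by move=> iA ab; rewrite edge_val_ray_first // ler0n. Qed.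

Lemma innerP I a b : reflect
  (E a b /\ forall A, A \in I -> edge_val (ray A) a b = 0) (inner E I (inl a) (inr b)).
Proof.
apply: (iffP andP) => -[ab h]; split=> //.
  by move=> A AI; rewrite edge_val_ray (same_classP _ _ _ h A AI) subrr.
apply/same_classP => A AI; have /eqP := h A AI.
by rewrite edge_val_ray; case: (cut A (inl a)); case: (cut A (inr b)).
Qed.

Definition vanishes I y : Prop := forall a b, inner E I (inl a) (inr b) -> edge_val y a b = 0.

Definition in_span I y : Prop := exists c, eqN y (\sum_(A in I) c A *: ray A).

Lemma comb_rayE I (c : {set V} -> rat) v :
  (\sum_(A in I) c A *: ray A) v =
  (if part_of v then - \sum_(A in I) c A * (cut A v)%:R
   else \sum_(A in I) c A * (cut A v)%:R) :> rat.
Proof.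
rewrite sum_ffunE; case sv: (part_of v); rewrite -?sumrN; apply: eq_bigr => A _.
  by rewrite !ffunE sv /= -mulrN.
by rewrite !ffunE sv.
Qed.

(** The indicator of an isolated u vanishes on all inner edges, yet up to sign and a constant a
    combination of rays takes equal values at u and at any v in its class. *)
Lemma span_no_isolated I :
  (forall y, vanishes I y -> in_span I y) -> no_isolated E I.
Proof.
move=> h u v nuv uv.
have [/existsP [x ux]|/existsPn nu] := boolP [exists x, inner E I u x]; first by exists x.
have [|c /eqNP [k e]] := h [ffun w => (w == u)%:R].
  move=> a b ab; rewrite /edge_val !ffunE.
  have -> : (inl a == u) = false.
    by apply/eqP => au; have := nu (inr b); rewrite -au ab.
  have -> : (inr b == u) = false; last exact: addr0.
  by apply/eqP => bu; have := nu (inl a); rewrite -bu inner_sym ab.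
have {}uv := same_classP _ _ _ uv.
have eS : \sum_(A in I) c A * (cut A u)%:R = \sum_(A in I) c A * (cut A v)%:R.
  by apply: eq_bigr => A /uv ->.
have := e u; have := e v; rewrite !comb_rayE !ffunE eqxx eq_sym (negbTE nuv) -eS /=.
by case: (part_of u); case: (part_of v); lra.
Qed.

(** Zero is a multiple by any k, so a primitive vector cannot vanish in N; the contradiction is
    obtained with k = 0. *)
Lemma eqN0 y k : eqN y 0 -> primitive y -> k = 1%N.
Proof.
move=> y0 [_ h]; apply: (h k 0); last by rewrite mul0rn.
by apply/forallP => v; rewrite ffunE rpred0.
Qed.

Hypothesis ferrersE : ferrers E.

Lemma first_in_span I y : I \subset FI -> no_isolated E I -> vanishes I y -> in_span I y.
Proof.
(* With this sign change [edge_val y a b] is the difference of f at the endpoints, so vanishing on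
   inner edges means that f is constant along them. *)
move=> IF niso yI; pose f v : rat := if part_of v then y v else - y v.
have [|k [c h]] := first_span ferrersE (f := f) IF niso.
  have key a b : inner E I (inl a) (inr b) -> f (inl a) = f (inr b).
    by move=> /yI /eqP; rewrite /edge_val addr_eq0 => /eqP.
  move=> [a|b] [a'|b']; [by []|exact: key| |by []].
  by rewrite inner_sym => /key.
exists (fun A => - c A); apply/eqNP; exists k => v; rewrite comb_rayE.
rewrite (eq_bigr (fun A => - (c A * (cut A v)%:R))) => [|A _]; last by rewrite mulNr.
by have := h v; rewrite /f sumrN; case: (part_of v); lra.
Qed.

(** On every edge the indicator of the neighbourhood minus that of the trace of A takes the value of
    [ray A], whichever side s is used; so both traces of a two-sided set define the same ray. *)
Lemma hyperplane_ray A s x : A \in FI -> A :&: part s != set0 -> dual_edge_cone E x ->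
  (hyperplane E (A :&: part s) x <-> pairing x (ray A) = 0).
Proof.
move=> AF As xd; have iA : independent E A by case/first_independentP: AF.
pose ind B : QV := [ffun v => (v \in B)%:R].
have sumE B : \sum_(v in B) (x v : rat) = pairing x (ind B).
  rewrite /pairing big_mkcond; apply: eq_bigr => v _; rewrite ffunE.
  by case: (v \in B); rewrite ?mulr1 ?mulr0.
rewrite /hyperplane !sumE; set B := A :&: part s.
suff -> : pairing x (ray A) = pairing x (ind (nbh E B)) - pairing x (ind B).
  by split=> [->|/eqP]; [rewrite subrr | rewrite subr_eq0 => /eqP].
case: xd => c _ ->; rewrite !pairing_edge_comb -sumrB; apply: eq_bigr => a _.
rewrite -sumrB; apply: eq_bigr => b ab; rewrite -mulrBr; congr (_ * _).
rewrite edge_val_ray_first // /edge_val !ffunE.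
have inB v : (v \in B) = (v \in A) && (part_of v == s) by rewrite in_setI in_part.
have nB v : part_of v = s -> (v \in nbh E B) = false.
  move=> sv; apply/negbTE; apply/negP; rewrite inE => /existsP [w].
  by rewrite inB => /andP [/andP [_ /eqP sw] /adj_side]; rewrite sv sw; case: (s).
have nA v : part_of v = ~~ s -> (v \in nbh E B) = (v \notin A) by exact: nbh_first.
rewrite !inB /=; have := independent_adj (u := inl a) (v := inr b) iA.
move: nB nA; case: (s) => nB nA /=.
  rewrite (nB (inl a)) // (nA (inr b)) // andbT andbF.
  case: (inl a \in A) => /= [/(_ isT ab) ->|_]; last case: (inr b \in A);
  by rewrite /nat_of_bool /=; ring.
rewrite (nB (inr b)) // (nA (inl a)) // andbT andbF.
case: (inl a \in A) => /= [/(_ isT ab) /negbTE ->|_]; last case: (inr b \in A);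
by rewrite /nat_of_bool /=; ring.
Qed.

Lemma edge_cone_ray A : independent E A -> edge_cone E (ray A).
Proof. by move=> iA; apply/edge_coneP => a b; exact: edge_val_ray_ge0. Qed.

Lemma first_independent_ind A : A \in FI -> independent E A.
Proof. by case/first_independentP. Qed.

Lemma edge_val_out A : A \in FI -> exists a b, E a b /\ edge_val (ray A) a b = 1.
Proof.
move=> AF; have iA := first_independent_ind AF.
have key a b : E a b -> inl a \notin A -> inr b \notin A ->
    exists a b, E a b /\ edge_val (ray A) a b = 1.
  by move=> ab aA bA; exists a, b; rewrite edge_val_ray_first // aA bA.
have [[a|b] [[a'|b'] [//= ab aA bA]]] := edge_out ferrersE AF; exact: key ab _ _.
Qed.

Lemma dual_rayE A s y : A \in FI -> A :&: part s != set0 ->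
  (dual_ray E (A :&: part s) y <-> exists2 c : rat, 0 <= c & eqN y (c *: ray A)).
Proof.
move=> AF As; have iA := first_independent_ind AF; split.
- move=> [/edge_coneP ys h].
  have [|||c] := @first_in_span [set A] y.
  + by apply/subsetP => B /set1P ->.
  + exact: no_isolated1.
  + move=> a b /innerP [ab /(_ A (set11 A)) e].
    rewrite -pairing_edge_vec; apply: h; first exact: edge_vec_dual.
    by apply/hyperplane_ray => //; [exact: edge_vec_dual | rewrite pairing_edge_vec].
  rewrite big_set1 => e; exists (c A) => //.
  have [a [b [ab eA]]] := edge_val_out AF.
  by have := ys a b ab; rewrite (eqN_edge_val _ _ e) edge_valZ eA mulr1.
- move=> [c c0 e]; split.
    apply/edge_coneP => a b ab; rewrite (eqN_edge_val _ _ e) edge_valZ.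
    by rewrite mulr_ge0 ?edge_val_ray_ge0.
  move=> x xd /(hyperplane_ray AF As xd) xA.
  by rewrite (pairing_eqN (dual_edge_cone_inM xd) e) pairingZr xA mulr0.
Qed.

Lemma is_Pi_ray A u : A \in FI -> is_Pi E A u -> exists2 c : rat, 0 < c & eqN u (c *: ray A).
Proof.
move=> AF [s As [pu h]].
have /(dual_rayE _ AF As) [c c0 e] : dual_ray E (A :&: part s) u.
  by apply/h; exists 1; rewrite ?scale1r ?eqN_refl.
exists c => //; rewrite lt_neqAle c0 andbT eq_sym; apply/eqP => c00.
by move: e; rewrite c00 scale0r => e0; have := eqN0 0%N e0 pu.
Qed.

(** For primitivity compare u in A with v outside A in the same part: the multiple of [wvec] cancels
    in the difference of their coordinates, which is -1, so k divides 1. *)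
Lemma ray_is_Pi A : A \in FI -> is_Pi E A (ray A).
Proof.
move=> AF; have iA := first_independent_ind AF.
have [s [u [v [us vs uA vA]]]] : exists s u v, [/\ part_of u = s, part_of v = s, u \in A & v \notin A].
  case/first_independentP: AF => _ [[tA _]|[s [w [ws e]]]].
    have [u uA us] := two_sided_mem true tA; have [v vA vs] := two_sided_notin true tA.
    by exists true, u, v.
  have [u [uw us _]] := full_neq ferrersE s w.
  by exists s, u, w; rewrite e !in_one_sided uw us ws !eqxx.
have As : A :&: part s != set0 by apply/set0Pn; exists u; rewrite inE uA in_part us eqxx.
exists s => //; split; last by move=> y; exact: dual_rayE.
split.
  by apply/forallP => w; rewrite ffunE; case: (part_of w); rewrite ?rpredN rpred_nat.
move=> k z zint /eqNP [c h].
have zE w : exists m : int, (z w : rat) = m%:~R.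
  by have /forallP /(_ w) /intrP [m ->] := zint; exists m.
have [m em] := zE u; have [n en] := zE v.
have zkE w : (z *+ k) w = z w * k%:R :> rat.
  have -> : z *+ k = (k%:R : rat) *: z by rewrite scaler_nat.
  by rewrite ffunE mulrC.
have rayE w : ray A w = (if part_of w then - (cut A w)%:R else (cut A w)%:R) :> rat.
  by rewrite ffunE.
have := h u; have := h v.
rewrite !zkE !rayE em en /cut (negbTE vA) uA us vs => e1 e2.
have : (m - n) * k%:Z = (if s then -1 else 1) * (if s then 1 else 1) \/
       (m - n) * k%:Z = (if s then -1 else 1) * (if s then 1 else -1).
  case: (s) e1 e2 => /= e1 e2; [left|right]; apply: (@intr_inj rat);
  rewrite !rmorphM /= rmorphB /=; lra.
move=> e; have : (`|m - n| * k)%N = 1%N.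
  by case: e => /(congr1 absz); rewrite abszM; case: (s).
by move=> /eqP; rewrite muln_eq1 => /andP [_ /eqP].
Qed.

End Cone.

(** * Faces of the edge cone *)

Section Faces.
Variables (T1 T2 : finType) (E : T1 -> T2 -> bool).
Local Notation V := (T1 + T2)%type.
Local Notation QV := {ffun V -> rat^o}.
Local Notation FI := (first_independent E).
Implicit Types (A B C : {set V}) (I J : {set {set V}}) (s t : bool) (y z x : QV).

Hypothesis ferrersE : ferrers E.

Lemma edge_val_01 A a b : A \in FI -> E a b ->
  edge_val (ray A) a b = 0 \/ edge_val (ray A) a b = 1.
Proof.
move=> AF ab; rewrite (edge_val_ray_first (first_independent_ind AF) ab).
by case: (_ && _); [right | left].
Qed.

(** The functional supporting the face is nonnegative on y and z and vanishes on their sum, hence on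
    y. The factors [g A] only rescale the chosen generators to [ray A]. *)
Lemma face_summand d I y z (k : {set V} -> rat) : forms_face E d I ->
    edge_cone E y -> edge_cone E z -> (forall A, 0 <= k A) ->
    eqN (y + z) (\sum_(A in I) k A *: ray A) ->
  exists2 c : {set V} -> rat, (forall A, 0 <= c A) & eqN y (\sum_(A in I) c A *: ray A).
Proof.
move=> [/subsetP IF cI [P [PPi [x [xM xpos xF]] _]]] yE zE k0 e.
have [g gP] : exists g : {set V} -> rat, forall A, A \in I ->
    0 < g A /\ eqN (P A) (g A *: ray A).
  have /fin_all_exists [g gP] : forall A : {set V}, exists c : rat, A \in I ->
      0 < c /\ eqN (P A) (c *: ray A).
    move=> A; have [AI|] := boolP (A \in I); last by exists 0.
    by have [c c0 h] := is_Pi_ray ferrersE (IF A AI) (PPi A AI); exists c.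
  by exists g.
have over : cone_over I P (\sum_(A in I) k A *: ray A).
  exists (fun A => if A \in I then k A / g A else 0) => [A|].
    by case: ifP => // AI; rewrite divr_ge0 // ltW //; case: (gP A AI).
  apply: eqN_sum => A AI; have [g0 h] := gP A AI; rewrite AI.
  have -> : k A *: ray A = (k A / g A) *: (g A *: ray A).
    by rewrite scalerA divfK // gt_eqF.
  by apply: eqNZ; rewrite eqN_sym.
have [_] := (xF _).1 over; rewrite -(pairing_eqN xM e) pairingDr.
move=> /eqP; rewrite paddr_eq0 ?xpos // => /andP [/eqP xy _].
have [c c0 h] := (xF y).2 (conj yE xy).
exists (fun A => if A \in I then c A * g A else 0) => [A|].
  by case: ifP => // AI; rewrite mulr_ge0 // ltW //; case: (gP A AI).
apply: eqN_trans h _; apply: eqN_sum => A AI; have [g0 h] := gP A AI.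
by rewrite AI -scalerA; apply: eqNZ.
Qed.

(** With K at least every absolute edge value of y, the sum S of the rays scaled by K absorbs y: S +
    y and S - y lie in the edge cone, since on a non-inner edge some ray has value 1. Their sum 2S
    is in the face, and so is S + y. *)
Lemma forms_face_span d I y : forms_face E d I -> vanishes E I y -> in_span I y.
Proof.
move=> fI yI; have [/subsetP IF _ _] := fI.
pose K : rat := \sum_a \sum_b `|edge_val y a b|.
have K0 : 0 <= K by apply: sumr_ge0 => a _; apply: sumr_ge0.
have Ky a b : `|edge_val y a b| <= K.
  rewrite /K (bigD1 a) //= (bigD1 b) //= -addrA lerDl addr_ge0 //; first exact: sumr_ge0.
  by apply: sumr_ge0 => ? _; apply: sumr_ge0.
pose S : QV := \sum_(A in I) K *: ray A.
have SE a b : E a b -> `|edge_val y a b| <= edge_val S a b.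
  move=> ab; rewrite edge_val_sum.
  have S0 (J : {set {set V}}) : J \subset I -> 0 <= \sum_(A in J) edge_val (K *: ray A) a b.
    move=> /subsetP JI; apply: sumr_ge0 => A AJ; rewrite edge_valZ mulr_ge0 //.
    by rewrite (edge_val_ray_ge0 (first_independent_ind (IF A (JI A AJ)))).
  have [inn|] := boolP (inner E I (inl a) (inr b)).
    by rewrite (yI _ _ inn) normr0 S0.
  move=> ninn; have [/existsP [A /andP [AI nA]]|/existsPn h] :=
    boolP [exists A, (A \in I) && (edge_val (ray A) a b != 0)].
    rewrite (big_setD1 A AI) /= edge_valZ.
    have [e|->] := edge_val_01 (IF A AI) ab; first by rewrite e eqxx in nA.
    by rewrite mulr1; apply: le_trans (Ky a b) _; rewrite lerDl S0 // subsetDl.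
  case/negP: ninn; apply/innerP; split=> // A AI.
  by have := h A; rewrite AI /= negbK => /eqP.
have [||||c _ e] := @face_summand d I (y + S) (S - y) (fun=> 2 * K) fI.
- apply/edge_coneP => a b ab; rewrite edge_valD; have := SE a b ab.
  by rewrite ler_norml => /andP [h _]; lra.
- apply/edge_coneP => a b ab; rewrite edge_valD -scaleN1r edge_valZ mulN1r.
  by have := SE a b ab; rewrite ler_norml subr_ge0 => /andP [].
- by move=> _; rewrite mulr_ge0.
- rewrite addrC addrA subrK /S -big_split /=.
  apply: eqN_sum => A _; rewrite -scalerDl (_ : K + K = 2 * K) ?eqN_refl //; ring.
exists (fun A => c A - K).
have -> : \sum_(A in I) (c A - K) *: ray A = \sum_(A in I) c A *: ray A - S.
  by rewrite /S -sumrB; apply: eq_bigr => A _; rewrite scalerBl.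
have -> : y = (y + S) + -1 *: S by rewrite scaleN1r addrK.
by rewrite -scaleN1r; apply: eqND => //; apply: eqN_refl.
Qed.

Lemma forms_face_no_isolated d I : forms_face E d I -> no_isolated E I.
Proof. by move=> fI; apply: span_no_isolated => y; exact: forms_face_span fI. Qed.

(** An edge where [ray A] has value 1 forces c = 1, and comparing the cuts at its two endpoints then
    forces the multiple of [wvec] to be zero. *)
Lemma ray_inj A B (c : rat) : A \in FI -> B \in FI -> eqN (ray A) (c *: ray B) -> A = B.
Proof.
move=> AF BF e; have [a [b [ab vA]]] := edge_val_out ferrersE AF.
have c1 : c = 1.
  have := eqN_edge_val a b e; rewrite edge_valZ vA.
  by case: (edge_val_01 BF ab) => ->; rewrite ?mulr0 ?mulr1 // => /eqP; rewrite oner_eq0.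
move: e; rewrite c1 scale1r => /eqNP [k h].
have rayE (D : {set V}) v : ray D v = (if part_of v then - (cut D v)%:R else (cut D v)%:R) :> rat.
  by rewrite ffunE.
have hk v : (cut A v)%:R = (cut B v)%:R - k.
  by have := h v; rewrite !rayE; case: (part_of v); lra.
have k0 : k = 0.
  move: vA; rewrite edge_val_ray.
  have := hk (inr b); have := hk (inl a).
  case: (cut A (inl a)); case: (cut A (inr b)); case: (cut B (inl a));
  case: (cut B (inr b)); rewrite /nat_of_bool; lra.
apply/setP => v; have := hk v; rewrite k0 subr0 /cut.
case: (v \in A); case: (v \in B) => //; case: (part_of v) => //= /eqP;
  by rewrite ?oner_eq0 // eq_sym oner_eq0.
Qed.

(** Otherwise [ray A] would vanish on all edges of G{B}, making it a multiple of [ray B]. *)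
Lemma pair_witness A B : A \in FI -> B \in FI -> A != B ->
  exists a b, [/\ E a b, edge_val (ray A) a b = 1 & edge_val (ray B) a b = 0].
Proof.
move=> AF BF nAB.
have [/existsP [a /existsP [b /and3P [ab vA /eqP vB]]]|/existsPn no] :=
  boolP [exists a, exists b, [&& E a b, edge_val (ray A) a b != 0 & edge_val (ray B) a b == 0]].
  exists a, b; split=> //; case: (edge_val_01 AF ab) => // v0.
  by rewrite v0 eqxx in vA.
have [|||c] := @first_in_span _ _ E ferrersE [set B] (ray A).
- by apply/subsetP => C /set1P ->.
- exact: no_isolated1.
- move=> a b /innerP [ab /(_ B (set11 B)) vB]; apply/eqP.
  have /existsPn /(_ b) := no a.
  by rewrite ab vB eqxx andbT negbK.
by rewrite big_set1 => /(ray_inj AF BF) e; rewrite e eqxx in nAB.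
Qed.

(** Otherwise [ray A] lies in the span of the rays of B and C. Edges separating those two rays show
    that both coefficients are 0 or 1, and only the sum of the two rays is not immediately
    excluded. *)
Lemma triple_witness A B C : A \in FI -> B \in FI -> C \in FI ->
    A != B -> A != C -> B != C ->
    forms_face E 2 [set B; C] -> forms_face E 2 [set A; B] ->
  exists a b, [/\ E a b, edge_val (ray A) a b != 0, edge_val (ray B) a b = 0
                & edge_val (ray C) a b = 0].
Proof.
move=> AF BF CF nAB nAC nBC fBC fAB.
have [/existsP [a /existsP [b /and4P [ab vA /eqP vB /eqP vC]]]|/existsPn no] :=
  boolP [exists a, exists b, [&& E a b, edge_val (ray A) a b != 0,
           edge_val (ray B) a b == 0 & edge_val (ray C) a b == 0]].
  by exists a, b.
have [|c] := @forms_face_span _ _ (ray A) fBC.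
  move=> a b /innerP [ab h]; apply/eqP; have /existsPn /(_ b) := no a.
  by rewrite ab (h B) ?set21 // (h C) ?set22 // !eqxx !andbT negbK.
rewrite big_setU1 ?inE //= big_set1 => e.
have eE a b : edge_val (ray A) a b = c B * edge_val (ray B) a b + c C * edge_val (ray C) a b.
  by rewrite (eqN_edge_val _ _ e) edge_valD !edge_valZ.
have [a1 [b1 [ab1 vB1 vC1]]] := pair_witness BF CF nBC.
have nCB : C != B by rewrite eq_sym.
have [a2 [b2 [ab2 vC2 vB2]]] := pair_witness CF BF nCB.
have := edge_val_01 AF ab1; have := edge_val_01 AF ab2.
rewrite !eE vB1 vC1 vB2 vC2 !mulr0 !mulr1 addr0 add0r => cC cB.
case: cC => cC; case: cB => cB; move: e eE; rewrite cB cC ?scale0r ?scale1r ?add0r ?addr0.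
- move=> e _; have [a [b [_ ]]] := edge_val_out ferrersE AF.
  by rewrite (eqN_edge_val _ _ e) /edge_val !ffunE addr0 => /eqP; rewrite eq_sym oner_eq0.
- move=> e _; have := ray_inj (c := 1) AF BF; rewrite scale1r => /(_ e) eAB.
  by rewrite eAB eqxx in nAB.
- move=> e _; have := ray_inj (c := 1) AF CF; rewrite scale1r => /(_ e) eAC.
  by rewrite eAC eqxx in nAC.
(* If [ray A] is the sum of the rays of B and C, extremality of the face of A and B puts [ray C] in
   its cone; the two separating edges then give coefficient 1 for A and -1 for B. *)
- move=> e eE; have [||||g g0] := @face_summand 2 [set A; B] (ray C) (ray B) (fun D => (D == A)%:R) fAB.
  + exact: edge_cone_ray (first_independent_ind CF).
  + exact: edge_cone_ray (first_independent_ind BF).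
  + by move=> D; rewrite ler0n.
  + rewrite big_setU1 ?inE //= big_set1 eqxx scale1r eq_sym (negbTE nAB) scale0r addr0.
    by rewrite addrC eqN_sym.
  rewrite big_setU1 ?inE //= big_set1 => e'.
  have := eqN_edge_val a2 b2 e'; have := eqN_edge_val a1 b1 e'.
  rewrite !edge_valD !edge_valZ !eE vB1 vC1 vB2 vC2.
  by have := g0 B; lra.
Qed.

Lemma rankN_size (X : seq QV) :
    (forall k : 'I_(size X) -> rat, eqN (\sum_i k i *: X`_i) 0 -> forall i, k i = 0) ->
  rankN X = size X.
Proof.
move=> h; have fX : free (in_tuple X).
  by apply/freeP => k e; apply: h; rewrite e eqN_refl.
have dj : (<<X>> :&: <[wvec T1 T2]> = 0)%VS.
  apply/eqP; rewrite -subv0; apply/subvP => v; rewrite memv_cap => /andP [vX vw].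
  have /(coord_span (X := in_tuple X)) e : v \in <<in_tuple X>>%VS by [].
  rewrite memv0 e big1 // => i _; rewrite (h (fun i => coord (in_tuple X) i v)) ?scale0r //.
  by rewrite /eqN subr0 -e.
rewrite /rankN dimv_disjoint_sum // addnK.
by move: fX; rewrite /free => /eqP.
Qed.

(** An edge on which A alone has nonzero value reads off the coefficient of A; this gives
    nonnegativity of the coefficients and independence of the rays modulo [wvec]. *)
Lemma forms_face_witness I : I \subset FI -> no_isolated E I ->
    (forall A, A \in I -> exists a b, [/\ E a b, edge_val (ray A) a b != 0
      & forall B, B \in I -> B != A -> edge_val (ray B) a b = 0]) ->
  forms_face E #|I| I.
Proof.
move=> IF niso wit; have IF' := subsetP IF.
have inC A a b : A \in I -> E a b -> 0 <= edge_val (ray A) a b.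
  by move=> AI ab; rewrite (edge_val_ray_ge0 (first_independent_ind (IF' A AI))).
have overE (y : QV) (c : {set V} -> rat) a b : eqN y (\sum_(A in I) c A *: ray A) ->
    edge_val y a b = \sum_(A in I) c A * edge_val (ray A) a b.
  move=> e; rewrite (eqN_edge_val _ _ e) edge_val_sum.
  by apply: eq_bigr => A _; rewrite edge_valZ.
split=> //; exists (@ray T1 T2); split.
- by move=> A AI; apply: ray_is_Pi (IF' A AI).
(* The sum of all inner edge vectors supports the face: on the edge cone it vanishes exactly where
   every inner edge value does. *)
- pose c a b : rat := (inner E I (inl a) (inr b))%:R.
  exists (\sum_a \sum_(b | E a b) c a b *: edge_vec a b).
  have c0 a b : 0 <= c a b by rewrite ler0n.
  have xd : dual_edge_cone E (\sum_a \sum_(b | E a b) c a b *: edge_vec a b) by exists c.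
  split; [exact: dual_edge_cone_inM xd | by move=> y; apply |].
  move=> y; rewrite pairing_edge_comb; split.
    move=> [g g0 e]; split.
      apply/edge_coneP => a b ab; rewrite (overE _ _ _ _ e).
      by apply: sumr_ge0 => A AI; rewrite mulr_ge0 ?inC.
    rewrite big1 // => a _; rewrite big1 // => b ab; rewrite /c.
    case: (boolP (inner _ _ _ _)) => [/innerP [_ h]|]; last by rewrite mul0r.
    by rewrite (overE _ _ _ _ e) big1 ?mulr0 // => A AI; rewrite h // mulr0.
  move=> [/edge_coneP yE /eqP]; rewrite psumr_eq0 => [/allP h|a _]; last first.
    by apply: sumr_ge0 => b ab; rewrite mulr_ge0 ?yE.
  have [|g e] := first_in_span ferrersE (y := y) IF niso.
    move=> a b inn; have [ab _] := innerP _ _ _ _ inn.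
    have := h a; rewrite mem_index_enum => /(_ isT) /=.
    rewrite psumr_eq0 => [/allP /(_ b)|b' ab']; last by rewrite mulr_ge0 ?yE.
    by rewrite mem_index_enum ab /c inn mul1r => /(_ isT) /eqP.
  exists (fun A => if A \in I then g A else 0) => [A|]; last first.
    apply: eqN_trans e _; apply: eqN_sum => A AI; rewrite AI; exact: eqN_refl.
  case: ifP => // AI; have [a [b [ab vA vB]]] := wit A AI.
  have := yE a b ab; rewrite (overE _ _ _ _ e) (big_setD1 A AI) /= big1 => [|B].
    by rewrite addr0; case: (edge_val_01 (IF' A AI) ab) vA => ->; rewrite ?eqxx ?mulr1.
  by rewrite in_setD1 => /andP [nB BI]; rewrite vB // mulr0.
- exists [seq ray A | A <- enum I]; split.
  + move=> y /mapP [A]; rewrite mem_enum => AI ->.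
    exists (fun B => (B == A)%:R) => [B|]; first by rewrite ler0n.
    rewrite (big_setD1 A AI) /= eqxx scale1r big1 ?addr0 ?eqN_refl // => B.
    by rewrite in_setD1 => /andP [/negbTE -> _]; rewrite scale0r.
  + move=> y [c _ e]; rewrite -(subrK (\sum_(A in I) c A *: ray A) y) addrC.
    apply: memv_add => //; apply: memv_suml => A AI; apply: memvZ.
    by apply: memv_span; apply: map_f; rewrite mem_enum.
  + rewrite rankN_size ?size_map -?cardE // => k e i.
    have i_lt : (i < size (enum I))%N by rewrite -cardE.
    pose A j := nth set0 (enum I) j.
    have AI j : (j < size (enum I))%N -> A j \in I by move=> lj; rewrite -mem_enum mem_nth.
    have [a [b [ab vA vB]]] := wit (A i) (AI i i_lt).
    have := eqN_edge_val a b e; rewrite [RHS]/edge_val !ffunE addr0 edge_val_sum.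
    rewrite (bigD1 i) //= big1 => [|j ji].
      rewrite addr0 edge_valZ (nth_map set0) // => /eqP.
      by rewrite mulf_eq0 (negbTE vA) orbF => /eqP.
    have j_lt : (j < size (enum I))%N by rewrite -cardE.
    rewrite edge_valZ (nth_map set0) // -/(A j) vB ?mulr0 ?AI //.
    by rewrite /A nth_uniq ?enum_uniq.
Qed.

Lemma cards3D1 I A : #|I| = 3%N -> A \in I -> #|I :\ A| = 2%N.
Proof. by move=> I3 AI; have := cardsD1 A I; rewrite AI I3 => -[] /esym. Qed.

Lemma cards3_pairs I : #|I| = 3%N -> exists A B C,
  [/\ A != B, A != C, B != C & I = [set A; B; C]].
Proof.
move=> I3; have /card_gt0P [A AI] : (0 < #|I|)%N by rewrite I3.
have /cards2P [B [C [nBC eBC]]] : #|I :\ A| == 2%N by rewrite cards3D1.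
have : B \in I :\ A by rewrite eBC set21.
have : C \in I :\ A by rewrite eBC set22.
rewrite !in_setD1 => /andP [CA _] /andP [BA _].
exists A, B, C; split; rewrite // 1?eq_sym //.
by rewrite -(setD1K AI) eBC setUA.
Qed.

Lemma triple_setD1 I A : pairwise_face_triple E I -> A \in I -> forms_face E 2 (I :\ A).
Proof.
move=> [_ I3 h] AI.
have /cards2P [B [C [nBC eBC]]] : #|I :\ A| == 2%N by rewrite cards3D1.
rewrite eBC; apply: h => //.
  by have := set21 B C; rewrite -eBC in_setD1 => /andP [].
by have := set22 B C; rewrite -eBC in_setD1 => /andP [].
Qed.

Lemma triple_no_isolated I A : pairwise_face_triple E I -> A \in I -> no_isolated E (I :\ A).
Proof. by move=> pI AI; exact: forms_face_no_isolated (triple_setD1 pI AI). Qed.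

Lemma triple_faceP I : pairwise_face_triple E I ->
  (forms_face E 3 I <-> no_isolated E I).
Proof.
move=> pI; split; first exact: forms_face_no_isolated.
have [IF I3 h] := pI; move=> niso; rewrite -I3; apply: forms_face_witness => // A AI.
have /cards2P [B [C [nBC eBC]]] : #|I :\ A| == 2%N by rewrite cards3D1.
have : B \in I :\ A by rewrite eBC set21.
have : C \in I :\ A by rewrite eBC set22.
rewrite !in_setD1 => /andP [CA CI] /andP [BA BI]; have IF' := subsetP IF.
have nAB : A != B by rewrite eq_sym.
have nAC : A != C by rewrite eq_sym.
have [a [b [ab vA vB vC]]] := triple_witness (IF' A AI) (IF' B BI) (IF' C CI)
  nAB nAC nBC (h B C BI CI nBC) (h A B AI BI nAB).
exists a, b; split=> // D DI nD.
have : D \in I :\ A by rewrite in_setD1 nD.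
by rewrite eBC in_set2 => /orP [] /eqP ->.
Qed.

End Faces.

(** * Triples of first independent sets *)

Section Triples.
Variables (T1 T2 : finType) (E : T1 -> T2 -> bool).
Local Notation V := (T1 + T2)%type.
Local Notation FI := (first_independent E).
Implicit Types (u v x : V) (A B C : {set V}) (I J : {set {set V}}) (s t : bool).

Hypothesis ferrersE : ferrers E.

Lemma isolated_not_face I u v : pairwise_face_triple E I -> u != v ->
  same_class I u v -> (forall x, ~~ inner E I u x) -> ~ forms_face E 3 I.
Proof.
by move=> pI nuv uv h /(triple_faceP ferrersE pI) /(_ u v nuv uv) [x]; rewrite (negbTE (h x)).
Qed.

(** Here u is isolated with a companion in its class. The last two conclusions pin down its
    neighbours: each is missed by some member of I, and for each D one is missed by D alone, because
    deleting D frees an edge at u. *)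
Lemma not_face_isolated I : pairwise_face_triple E I -> ~ forms_face E 3 I ->
  exists u, [/\ forall A, A \in I -> u \notin A,
    forall C C', C \in I -> C' \in I -> two_sided C -> two_sided C' -> C = C',
    forall s w, part s :\ w \in I -> part_of w = s -> part_of u = ~~ s,
    forall x, adj E u x -> exists2 A, A \in I & x \notin A
  & forall D, D \in I -> exists x,
      [/\ adj E u x, x \notin D & forall A, A \in I -> A != D -> x \in A]].
Proof.
move=> pI nf; have [IF _ _] := pI; have IF' := subsetP IF.
have niso A : A \in I -> no_isolated E (I :\ A) by exact: triple_no_isolated.
have [/existsP [u /existsP [v /and3P [nuv uv /forallP isou]]]|/existsPn ni] :=
  boolP [exists u, exists v, [&& u != v, same_class I u v & [forall x, ~~ inner E I u x]]];
  last first.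
  case: nf; apply/triple_faceP => // u v nuv uv.
  have /existsPn /(_ v) := ni u; rewrite nuv uv /= negb_forall => /existsP [x].
  by rewrite negbK; exists x.
have notin := isolated_notin IF uv nuv isou niso.
have nb x : adj E u x -> exists2 A, A \in I & x \notin A.
  move=> ux; have [/existsP [A /andP [AI xA]]|/existsPn h] :=
    boolP [exists A, (A \in I) && (x \notin A)]; first by exists A.
  have := isou x; rewrite /inner ux => /negP []; apply/same_classP => A AI.
  apply/eqP; rewrite (cut_adj (IF' A AI) ux); apply/orP; right.
  by have := h A; rewrite AI negbK.
exists u; split=> //.
- by have h := isolated_two_sided ferrersE IF uv nuv isou niso.
- by move=> s w AI; apply: isolated_one_sided uv nuv AI (notin _ AI).
- move=> D DI; have [x /andP [ux /same_classP h]] :=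
    niso D DI u v nuv (same_classS (subsetDl _ _) uv).
  have xA A : A \in I -> A != D -> x \in A.
    move=> AI AD; have /eqP : cut A u = cut A x by apply: h; rewrite in_setD1 AD.
    by rewrite (cut_adj (IF' A AI) ux) (negbTE (notin A AI)).
  exists x; split=> //; have [A AI xA'] := nb x ux.
  by have [<-//|AD] := eqVneq A D; rewrite xA in xA'.
Qed.

Lemma set3_rot (T : finType) (a b c : T) : [set a; b; c] = [set b; c; a].
Proof. by rewrite [RHS]setUC setUA. Qed.

Lemma not_face_form I : pairwise_face_triple E I -> ~ forms_face E 3 I ->
  exists s,
    (exists i i' i'' : V, [/\ i \in part s, i' \in part s, i'' \in part s
       & I = [set part s :\ i; part s :\ i'; part s :\ i'']]) \/
    (exists (i i' : V) (C : {set V}), [/\ i \in part s, i' \in part s, two_sided C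
       & I = [set part s :\ i; part s :\ i'; C]]).
Proof.
move=> pI nf; have [u [notin two one _ _]] := not_face_isolated pI nf.
have [IF I3 _] := pI; exists (~~ part_of u); move: IF two one notin pI.
have [A [B [C [nAB nAC nBC eI]]]] := cards3_pairs I3.
move=> IF two one _ _.
have kind D : D \in I ->
    two_sided D \/ exists2 w, w \in part (~~ part_of u) & D = part (~~ part_of u) :\ w.
  move=> DI; case: (first_independentP (subsetP IF D DI)) => _.
  case=> [[tD _]|[s [w [ws e]]]]; [by left | right].
  have us : part_of u = ~~ s by apply: (one s w) => //; rewrite -e.
  by exists w; rewrite ?in_part us negbK ?ws.
have [AI BI CI] : [/\ A \in I, B \in I & C \in I].
  by rewrite eI !inE !eqxx !orbT.
have dis D D' : D \in I -> D' \in I -> D != D' -> two_sided D -> two_sided D' -> False.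
  by move=> DI D'I /eqP nD tD tD'; apply: nD; apply: two.
case: (kind A AI) => [tA|[i iu eA]]; case: (kind B BI) => [tB|[i' i'u eB]];
  case: (kind C CI) => [tC|[i'' i''u eC]];
  try (by case: (dis A B)); try (by case: (dis A C)); try (by case: (dis B C)).
- by right; exists i', i'', A; split=> //; rewrite eI set3_rot eB eC.
- by right; exists i'', i, B; split=> //; rewrite eI -set3_rot eA eC.
- by right; exists i, i', C; split=> //; rewrite eI eA eB.
- by left; exists i, i', i''; split=> //; rewrite eI eA eB eC.
Qed.

Lemma one_sided_notin s x w : part_of x = s -> (x \notin part s :\ w) = (x == w).
Proof. by move=> xs; rewrite in_one_sided xs eqxx andbT negbK. Qed.

Lemma one_sided_triple s (i i' i'' : V) :
    i \in part s -> i' \in part s -> i'' \in part s ->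
    pairwise_face_triple E [set part s :\ i; part s :\ i'; part s :\ i''] ->
  (~ forms_face E 3 [set part s :\ i; part s :\ i'; part s :\ i''] <->
   exists C, [/\ C \in FI, two_sided C & C :&: part s = part s :\: [set i; i'; i'']]).
Proof.
rewrite !in_part => /eqP is_ /eqP i's /eqP i''s; set I := [set _; _; _] => pI.
have [/subsetP IF _ _] := pI.
have memI A : A \in I -> exists2 w, w \in [set i; i'; i''] & A = part s :\ w.
  by rewrite in_setU in_set2 in_set1 => /orP [/orP [] | ] /eqP ->;
    [exists i | exists i' | exists i'']; rewrite // !inE eqxx ?orbT.
have sw w : w \in [set i; i'; i''] -> part_of w = s.
  by rewrite in_setU in_set2 in_set1 => /orP [/orP [] | ] /eqP ->.
have wI w : w \in [set i; i'; i''] -> part s :\ w \in I.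
  by rewrite in_setU in_set2 in_set1 => /orP [/orP [] | ] /eqP ->; rewrite !inE eqxx ?orbT.
split.
- move=> nf; have [u [notin _ one nb near]] := not_face_isolated pI nf.
  have us : part_of u = ~~ s by apply: (one s i) => //; rewrite wI // !inE eqxx.
  (* A neighbour of u missed by [part s :\ w] can only be w. So the neighbours are among the three
     vertices, and each of these is attained by the neighbour attached to its set. *)
  have Nu x : adj E u x = (x \in [set i; i'; i'']).
    apply/idP/idP => [ux|xi].
      have [A /memI [w wi ->]] := nb x ux.
      by rewrite one_sided_notin ?(adj_side ux) ?us ?negbK // => /eqP ->.
    have [y [uy]] := near _ (wI x xi).
    by rewrite one_sided_notin ?(adj_side uy) ?us ?negbK // => /eqP <-.
  have [||tC0 mC0] := @nbr_set_maximal _ _ _ ferrersE u s; first by rewrite us negbK.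
    (* With at least four vertices, [part s] contains a non-neighbour of u, which makes
       [nbr_set E u] two-sided. *)
    have [_ _ big_part] := ferrersE.
    have /subsetPn [x xs xn] : ~~ (part s \subset [set i; i'; i'']).
      apply/negP => /subset_leq_card; apply/negP; rewrite -ltnNge.
      apply: leq_ltn_trans (big_part s).
      by rewrite !cardsU !cards1; lia.
    by exists x; [apply/eqP; rewrite -in_part | rewrite Nu].
  exists (nbr_set E u); split=> //; first exact: first_of_maximal.
  rewrite nbr_set_part ?us ?negbK //; apply/setP => x.
  by rewrite in_setD -Nu in_part inE andbC.
(* A vertex u of C opposite to [part s] has all its neighbours among the three removed vertices, and
   the edge to each w is cut by [part s :\ w]. No cut separates u from the other vertices of its
   part, so it is isolated with a companion. *)
- move=> [C [CF tC eC]].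
  have [u uC us] := two_sided_mem (~~ s) tC.
  have [v [nvu vs _]] := full_neq ferrersE (~~ s) u.
  have Nu x : adj E u x -> x \in [set i; i'; i''].
    move=> ux; have xC := independent_adj (first_independent_ind CF) uC ux.
    have : x \notin C :&: part s by rewrite in_setI (negbTE xC).
    by rewrite eC in_setD in_part (adj_side ux) us negbK eqxx andbT negbK.
  apply: (@isolated_not_face I u v) => //; first by rewrite eq_sym.
    apply/same_classP => A /memI [w /sw ws ->]; rewrite !cut_one_sided //.
    have nw x : part_of x = ~~ s -> (x == w) = false.
      by move=> xs; apply/negP => /eqP e; move: ws; rewrite -e xs; case: (s).
    by rewrite !nw.
  move=> x; apply/negP => /andP [ux /same_classP h].
  have xi := Nu x ux; have /eqP := h _ (wI x xi).
  rewrite (cut_adj (IF _ (wI x xi)) ux).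
  by rewrite !in_one_sided us eqxx /=; case: (s); rewrite andbF.
Qed.

Lemma mixed_triple s (i i' : V) C : i \in part s -> i' \in part s -> two_sided C ->
    pairwise_face_triple E [set part s :\ i; part s :\ i'; C] ->
  (~ forms_face E 3 [set part s :\ i; part s :\ i'; C] <->
   C :&: part s = [set i; i'] \/
   exists C', [/\ C' \in FI, two_sided C', C' :&: part s \subset C :&: part s
     & (C :&: part s) :\: (C' :&: part s) = [set i; i']]).
Proof.
rewrite !in_part => /eqP is_ /eqP i's tC; set I := [set _; _; _] => pI.
have [/subsetP IF _ _] := pI.
have wI w : w \in [set i; i'] -> part s :\ w \in I.
  by rewrite in_set2 => /orP [] /eqP ->; rewrite !inE eqxx ?orbT.
have CI : C \in I by rewrite !inE eqxx orbT.
have memI A : A \in I -> A = C \/ exists2 w, w \in [set i; i'] & A = part s :\ w.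
  rewrite in_setU in_set2 in_set1 => /orP [/orP [] | ] /eqP ->;
    [right; exists i | right; exists i' | by left]; rewrite // !inE eqxx ?orbT //.
have sw w : w \in [set i; i'] -> part_of w = s.
  by rewrite in_set2 => /orP [] /eqP ->.
have mC := first_two_sided (IF C CI) tC; have iC := maxset_independent mC.
split.
- move=> nf; have [u [notin _ one nb near]] := not_face_isolated pI nf.
  have us : part_of u = ~~ s by apply: (one s i) => //; rewrite wI // set21.
  have Nu x : x \in C -> adj E u x = (x \in [set i; i']).
    move=> xC; apply/idP/idP => [ux|xi].
      have [A /memI [->|[w wi ->]]] := nb x ux; first by rewrite xC.
      by rewrite one_sided_notin ?(adj_side ux) ?us ?negbK // => /eqP ->.
    have [y [uy]] := near _ (wI x xi).
    by rewrite one_sided_notin ?(adj_side uy) ?us ?negbK // => /eqP <-.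
  have iC' w : w \in [set i; i'] -> w \in C.
    move=> wi; have [y [uy]] := near _ (wI w wi).
    rewrite one_sided_notin ?(adj_side uy) ?us ?negbK // => /eqP <-; apply => //.
    apply/eqP => e; exact: (two_sided_one_sided_set tC e).
  have [eC|nC] := eqVneq (C :&: part s) [set i; i']; [by left | right].
  have sub : [set i; i'] \subset C :&: part s.
    by apply/subsetP => w wi; rewrite in_setI iC' // in_part sw ?eqxx.
  have /subsetPn [z] : ~~ (C :&: part s \subset [set i; i']).
    by apply: contra nC => h; rewrite eqEsubset h.
  rewrite in_setI in_part => /andP [zC /eqP zs] zi.
  have [||tC0 mC0] := @nbr_set_maximal _ _ _ ferrersE u s; first by rewrite us negbK.
    by exists z; rewrite // Nu.
  exists (nbr_set E u); split=> //; first exact: first_of_maximal.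
    rewrite nbr_set_part ?us ?negbK //; apply/subsetP => x; rewrite inE => /andP [/eqP xs nux].
    rewrite in_setI in_part xs eqxx andbT; apply: contraT => xC.
    have [c cC xc] := maximal_nbr mC xC.
    have nst : nested E by case: ferrersE.
    (* If c sees nothing beyond the neighbours of u, then x is adjacent to u; if u sees nothing
       beyond those of c, then i and c are adjacent members of C. *)
    case: (nst c u); first by rewrite (adj_side xc) xs us.
      by move=> /(_ x); rewrite adj_sym xc (negbTE nux) => /(_ isT).
    move=> /(_ i); rewrite Nu ?iC' ?set21 // => /(_ isT) ci.
    by have := independent_adj iC cC ci; rewrite iC' ?set21.
  apply/setP => x; rewrite nbr_set_part ?us ?negbK // in_setD in_setI in_part inE.
  case xC: (x \in C) => /=; last by rewrite andbF; apply/esym/negP => /iC'; rewrite xC.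
  rewrite -Nu //; case: eqVneq => [_|xs] /=; first by rewrite negbK andbT.
  by apply/esym/negP => /adj_side e; rewrite e us negbK eqxx in xs.
(* Such a u is isolated: an edge at u not cut by C ends in C, hence at i or i', and the
   corresponding one-sided set cuts it. A full vertex, which is also outside C, serves as
   companion. *)
- move=> h; suff [u us uC Nu] : exists2 u, part_of u = ~~ s & u \notin C /\
      forall x, adj E u x -> x \in C -> x \in [set i; i'].
    have [v [nvu vs fv]] := full_neq ferrersE (~~ s) u.
    have vC := full_notin iC tC fv.
    case: uC Nu => uC Nu; apply: (@isolated_not_face I u v) => //; first by rewrite eq_sym.
      apply/same_classP => A /memI [->|[w /sw ws ->]].
        by rewrite /cut (negbTE uC) (negbTE vC) us vs.
      rewrite !cut_one_sided //.
      have nw x : part_of x = ~~ s -> (x == w) = false.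
        by move=> xs; apply/negP => /eqP e; move: ws; rewrite -e xs; case: (s).
      by rewrite !nw.
    move=> x; apply/negP => /andP [ux /same_classP hx].
    have xC : x \in C by have /eqP := hx C CI; rewrite (cut_adj (IF C CI) ux) (negbTE uC).
    have xi := Nu x ux xC; have /eqP := hx _ (wI x xi).
    rewrite (cut_adj (IF _ (wI x xi)) ux) !in_one_sided us eqxx /=.
    by case: (s); rewrite andbF.
  case: h => [eC|[C' [C'F tC' sub eC]]].
    have [u uC us] := two_sided_notin (~~ s) tC; exists u => //; split=> // x ux xC.
    by rewrite -eC in_setI xC in_part (adj_side ux) us negbK eqxx.
  have mC' := first_two_sided C'F tC'.
  (* If C' were inside C on the opposite part, C would be inside C' on [part s], contradicting i. A
     vertex u of C' outside C has no neighbour in C', so its neighbours in C are among i and i'. *)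
  have /subsetPn [u] : ~~ (C' :&: part (~~ s) \subset C).
    apply/negP => h; have := two_sided_antitone iC mC' h; rewrite negbK => hs.
    have : i \in C :&: part s :\: (C' :&: part s) by rewrite eC set21.
    rewrite in_setD => /andP [/negP nC' iCs]; apply: nC'.
    by rewrite in_setI (subsetP hs i iCs) in_part is_ eqxx.
  rewrite in_setI in_part => /andP [uC' /eqP us] uC; exists u => //; split=> // x ux xC.
  have xC' := independent_adj (maxset_independent mC') uC' ux.
  by rewrite -eC in_setD !in_setI (negbTE xC') xC in_part (adj_side ux) us negbK eqxx.
Qed.

End Triples.

(** * Rothe diagrams *)

Section UniqueDot.
Variables (N : nat) (pi : 'S_N).
Local Notation box := ('I_N * 'I_N)%type.
Implicit Types (p q : box) (j k : 'I_N).

(* The entry 1 of the permutation matrix in column j lies weakly north-west of p. *)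
Definition dot_le j p : bool := (pi j <= p.1)%N && (j <= p.2)%N.

Definition box_le p q : bool := (p.1 <= q.1)%N && (p.2 <= q.2)%N.

Lemma in_D p : (p \in D pi) = (p.2 < pi^-1%g p.1)%N && (p.1 < pi p.2)%N.
Proof.
case: p => a b; rewrite inE /=; apply/idP/idP.
  by case/existsP=> i /existsP [j /and3P [ij ji /eqP [-> ->]]]; rewrite permK ij ji.
move=> /andP [h1 h2]; apply/existsP; exists b; apply/existsP; exists (pi^-1%g a).
by rewrite h1 permKV h2 eqxx.
Qed.

Lemma in_NW p : p \in NW pi <-> exists2 q, q \in D pi & box_le p q.
Proof.
rewrite inE; split=> [/existsP [q /andP [qD h]]|[q qD h]]; first by exists q.
by apply/existsP; exists q; rewrite qD.
Qed.

Lemma dot_le_trans j p q : box_le p q -> dot_le j p -> dot_le j q.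
Proof. by move=> /andP [h1 h2] /andP [h3 h4]; rewrite /dot_le (leq_trans h3) ?(leq_trans h4). Qed.

Lemma side_comparable p q : side p q -> box_le p q \/ box_le q p.
Proof.
rewrite /box_le => /orP [] /andP [/eqP e /orP [] /eqP h];
  rewrite e leqnn ?andbT /=; lia.
Qed.

Lemma side_sym p q : side p q = side q p.
Proof. by congr (_ && _ || _ && _); rewrite 1?orbC // eq_sym. Qed.

Lemma D_strict_dot j p : p \in D pi -> dot_le j p -> (pi j < p.1)%N /\ (j < p.2)%N.
Proof.
rewrite in_D => /andP [h1 h2] /andP [h3 h4].
have [e|n1] := eqVneq (pi j) p.1.
  by move: h1; rewrite -e permK ltnNge h4.
have [e|n2] := eqVneq j p.2; first by move: h2; rewrite -e ltnNge h3.
by split; rewrite ltn_neqAle ?n1 ?n2.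
Qed.

Lemma no_dot_D p : (forall j, ~~ dot_le j p) -> p \in D pi.
Proof.
move=> h; rewrite in_D; have := h p.2; have := h (pi^-1%g p.1).
by rewrite /dot_le permKV !leqnn /= andbT -!ltnNge => -> ->.
Qed.

(** Every box weakly north-west of p is dot-free as well and so lies in D(pi); walking left to the
    first column and then up joins p to the corner. *)
Lemma no_dot_dom p : (forall j, ~~ dot_le j p) -> p \in Defs.dom pi.
Proof.
move=> nd; rewrite inE no_dot_D //=.
have N0 : (0 < N)%N by case: (p) => -[m hm] _; exact: leq_ltn_trans hm.
pose o : 'I_N := Ordinal N0.
have no q : box_le q p -> forall j, ~~ dot_le j q.
  by move=> qp j; apply: contra (nd j); exact: dot_le_trans.
suff conn n q : (q.1 + q.2 <= n)%N -> box_le q p -> connect (side_in (D pi)) (o, o) q.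
  have oD : (o, o) \in D pi by apply: no_dot_D; apply: no; rewrite /box_le /=.
  apply/existsP; exists (o, o); rewrite oD /=.
  by apply: (conn _ p (leqnn _)); rewrite /box_le !leqnn.
elim: n q => [|n IH] q qn qp.
  have -> : q = (o, o).
    case: q qn {qp} => a b /=; rewrite leqn0 addn_eq0 => /andP [/eqP a0 /eqP b0].
    by congr pair; apply: val_inj.
  exact: connect0.
have qD : q \in D pi by apply: no_dot_D; apply: no.
have step q' : box_le q' p -> (q'.1 + q'.2 <= n)%N -> side q' q ->
    connect (side_in (D pi)) (o, o) q.
  move=> q'p q'n sq; apply: connect_trans (IH q' q'n q'p) (connect1 _).
  by rewrite /side_in qD sq no_dot_D //; apply: no.
case: q qn qp qD step => -[[|a] ha] [[|b] hb] /= qn qp qD step.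
- by rewrite (_ : (_, _) = (o, o)) ?connect0 //; congr pair; apply: val_inj.
- apply: (step (Ordinal ha, Ordinal (ltnW hb))); rewrite /side /= ?eqxx //=.
  by move: qp; rewrite /box_le /= => /ltnW.
- apply: (step (Ordinal (ltnW ha), Ordinal hb)); rewrite /side /= ?eqxx ?orbT //=.
  by move: qp; rewrite /box_le /= => /andP [/ltnW -> ->].
- apply: (step (Ordinal ha, Ordinal (ltnW hb))); rewrite /side /= ?eqxx //=.
    by move: qp; rewrite /box_le /= => /andP [-> /ltnW ->].
  by move: qn; rewrite addnS ltnS.
Qed.

(** A dot weakly north-west of a box of D(pi) is strictly so, hence stays weakly north-west of the
    adjacent boxes. Having such a dot is thus constant on components of D(pi), and the corner has
    none. *)
Lemma dom_no_dot p j : p \in Defs.dom pi -> ~~ dot_le j p.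
Proof.
rewrite inE => /andP [pD /existsP [q /andP [qD /and3P [/eqP q1 /eqP q2 conn]]]].
have cl : closed (side_in (D pi)) [pred r | [exists j, dot_le j r]].
  suff imp r r' : r \in D pi -> r' \in D pi -> side r r' ->
      [exists j, dot_le j r] -> [exists j, dot_le j r'].
    move=> r r' /and3P [rD r'D sr]; rewrite !inE; apply/idP/idP; apply: imp => //.
    by rewrite side_sym.
  move=> rD r'D sr /existsP [k kr]; apply/existsP; exists k.
  have [h1 h2] := D_strict_dot rD kr; rewrite /dot_le.
  by move: sr => /orP [] /andP [/eqP <- /orP [] /eqP h]; apply/andP; split; lia.
have := closed_connect cl conn; rewrite !inE => e.
apply/negP => jp; have : [exists j, dot_le j p] by apply/existsP; exists j.
rewrite -e => /existsP [k /(D_strict_dot qD)]; rewrite q1.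
by case.
Qed.

Lemma in_L p : p \in L pi <-> p \in NW pi /\ exists j, dot_le j p.
Proof.
rewrite in_setD; split.
  move=> /andP [pd pN]; split=> //.
  have [/existsP //|/existsPn h] := boolP [exists j, dot_le j p].
  by rewrite no_dot_dom in pd.
by move=> [-> [j h]]; rewrite andbT; apply: contraL h; apply: dom_no_dot.
Qed.

Hypothesis unique_dot : forall q j k, q \in D pi -> dot_le j q -> dot_le k q -> j = k.
Hypothesis L_connected : box_connected (L pi).
Hypothesis three_ess : (3 <= #|Ess pi :&: L pi|)%N.

(** Adjacent boxes are comparable, and the larger lies weakly north-west of some box of D(pi).
    Uniqueness of the dot there makes the dots of both boxes equal, and connectedness propagates
    this. *)
Lemma L_dot : exists j, forall p, p \in L pi -> dot_le j p.
Proof.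
have /card_gt0P [p0] : (0 < #|Ess pi :&: L pi|)%N by apply: leq_trans three_ess.
rewrite in_setI => /andP [_ p0L]; have [_ [j jp0]] := (in_L p0).1 p0L.
exists j => p pL; have conn := L_connected p0L pL.
have cl : closed (side_in (L pi)) [pred r | dot_le j r].
  have down r r' : r \in L pi -> r' \in L pi -> box_le r r' -> dot_le j r = dot_le j r'.
    move=> rL r'L rr'; apply/idP/idP => [|jr']; first exact: dot_le_trans.
    have [_ [k kr]] := (in_L r).1 rL; have [/in_NW [q qD r'q] _] := (in_L r').1 r'L.
    rewrite (unique_dot (q := q) (j := j) (k := k)) //; first exact: dot_le_trans r'q jr'.
    by apply: dot_le_trans r'q _; apply: dot_le_trans rr' kr.
  move=> r r' /and3P [rL r'L /side_comparable [h|h]]; rewrite !inE; first exact: down.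
  by symmetry; apply: down.
by have := closed_connect cl conn; rewrite !inE jp0.
Qed.

Lemma ferrers_Gpi : ferrers (@Gpi N pi).
Proof.
have [j0 dotL] := L_dot.
have Ldown p q : q \in L pi -> box_le p q -> dot_le j0 p -> p \in L pi.
  move=> /in_L [/in_NW [r rD qr] _] pq jp; apply/in_L; split; last by exists j0.
  apply/in_NW; exists r => //; move: pq qr => /andP [h1 h2] /andP [h3 h4].
  by rewrite /box_le (leq_trans h1) ?(leq_trans h2).
have Lup p : p \in L pi -> exists q,
    [/\ q \in L pi, q \in D pi, box_le p q, (pi j0 < q.1)%N & (j0 < q.2)%N].
  move=> pL; have /in_L [/in_NW [q qD pq] _] := pL.
  have jq := dot_le_trans pq (dotL p pL); have [h1 h2] := D_strict_dot qD jq.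
  exists q; split=> //; apply/in_L; split; last by exists j0.
  by apply/in_NW; exists q => //; rewrite /box_le !leqnn.
have row_ge (a : Grow pi) : (pi j0 <= val a)%N.
  by have /existsP [b /dotL /andP []] := valP a.
have col_ge (b : Gcol pi) : (j0 <= val b)%N.
  by have /existsP [a /dotL /andP []] := valP b.
have /card_gt0P [p0] : (0 < #|Ess pi :&: L pi|)%N by apply: leq_trans three_ess.
rewrite in_setI => /andP [_ p0L].
have [q0 [q0L q0D _ q01 q02]] := Lup p0 p0L.
have essP q : q \in Ess pi :&: L pi ->
    [/\ q \in L pi, q \in D pi, (pi j0 < q.1)%N & (j0 < q.2)%N].
  rewrite in_setI inE => /andP [/andP [qD _] qL].
  by have [h1 h2] := D_strict_dot qD (dotL q qL).
split.
- move=> [a|b] [a'|b'] // _.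
  + wlog le : a a' / (val a <= val a')%N => [wl|].
      case: (leqP (val a) (val a')) => [/wl //|/ltnW /wl [] h]; by [right | left].
    right=> -[//|b]; rewrite /= /Gpi => h.
    by apply: Ldown h _ _; rewrite /box_le /dot_le /= ?le ?leqnn ?row_ge ?col_ge.
  + wlog le : b b' / (val b <= val b')%N => [wl|].
      case: (leqP (val b) (val b')) => [/wl //|/ltnW /wl [] h]; by [right | left].
    right=> -[a|//]; rewrite /= /Gpi => h.
    by apply: Ldown h _ _; rewrite /box_le /dot_le /= ?le ?leqnn ?row_ge ?col_ge.
- case.
  (* The full rows are that of the dot and the next one: each box of L(pi) is north-west of a box of
     D(pi) strictly below the dot, so both rows reach every column of the graph. *)
  + have c1N : ((pi j0).+1 < N)%N by apply: leq_ltn_trans q01 (ltn_ord _).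
    have rowL (a : 'I_N) : (pi j0 <= a)%N -> (a <= (pi j0).+1)%N ->
        exists2 v : Grow pi + Gcol pi, (if v is inl a' then val a' == a else false)
          & full (@Gpi N pi) v.
      move=> ca ac; have aP : [exists b, (a, b) \in L pi].
        apply/existsP; exists j0; apply: Ldown q0L _ _; rewrite /box_le /dot_le /= ?leqnn ?ca //.
        by rewrite (leq_trans ac q01) ltnW.
      exists (inl (exist _ a aP)) => //= -[//|b] _ /=.
      have /existsP [a' /Lup [q [qL _ /andP [_ /= bq] h _]]] := valP b.
      by apply: Ldown qL _ _; rewrite /box_le /dot_le /= ?bq ?ca ?col_ge // (leq_trans ac).
    have [u] := rowL (pi j0) (leqnn _) (leqnSn _).
    have [v] := rowL (Ordinal c1N) (leqnSn _) (leqnn _).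
    case: u => // a'; case: v => // a /eqP ea fa /eqP ea' fa'.
    exists (inl a'), (inl a); split=> //; apply/negP => /eqP [] e.
    by move: ea'; rewrite e ea => /(congr1 val) /= ?; lia.
  + have d1N : (j0.+1 < N)%N by apply: leq_ltn_trans q02 (ltn_ord _).
    have colL (b : 'I_N) : (j0 <= b)%N -> (b <= j0.+1)%N ->
        exists2 v : Grow pi + Gcol pi, (if v is inr b' then val b' == b else false)
          & full (@Gpi N pi) v.
      move=> ca ac; have bP : [exists a, (a, b) \in L pi].
        apply/existsP; exists (pi j0); apply: Ldown q0L _ _; rewrite /box_le /dot_le /= ?leqnn ?ca //.
        by rewrite (leq_trans ac q02) ltnW.
      exists (inr (exist _ b bP)) => //= -[a|//] _ /=.
      have /existsP [b' /Lup [q [qL _ /andP [/= aq _] _ h]]] := valP a.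
      by apply: Ldown qL _ _; rewrite /box_le /dot_le /= ?aq ?ca ?row_ge // (leq_trans ac).
    have [u] := colL j0 (leqnn _) (leqnSn _).
    have [v] := colL (Ordinal d1N) (leqnSn _) (leqnn _).
    case: u => // a'; case: v => // a /eqP ea fa /eqP ea' fa'.
    exists (inr a'), (inr a); split=> //; apply/negP => /eqP [] e.
    by move: ea'; rewrite e ea => /(congr1 val) /= ?; lia.
(* For two essential boxes in one row, the box just right of the first would lie in D(pi): otherwise
   its column would carry a dot north-west of q', which must be that of [j0], yet [j0] is left of
   q. *)
- have ess_row q q' : q \in Ess pi :&: L pi -> q' \in Ess pi :&: L pi ->
      q.1 = q'.1 -> (q.2 < q'.2)%N -> False.
    move=> qE q'E e1 lt2; have [qL qD _ qj] := essP q qE; have [q'L q'D _ _] := essP q' q'E.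
    have f1N : (q.2.+1 < N)%N by apply: leq_ltn_trans lt2 (ltn_ord _).
    move: qE; rewrite in_setI inE => /andP [/and3P [_ _ nE] _].
    case/negP: nE; apply/existsP; exists (q.1, Ordinal f1N); rewrite !eqxx in_D /= !andbT.
    move: (q'D); rewrite in_D => /andP [h1 h2]; apply/andP; split.
      by rewrite e1; apply: leq_ltn_trans h1.
    rewrite ltnNge; apply/negP => h.
    have jf : Ordinal f1N = j0.
      by apply: (unique_dot q'D); [rewrite /dot_le -e1 h | exact: dotL].
    by move: qj; rewrite -jf /= ltnNge leqnSn.
  have ess_col q q' : q \in Ess pi :&: L pi -> q' \in Ess pi :&: L pi ->
      q.2 = q'.2 -> (q.1 < q'.1)%N -> False.
    move=> qE q'E e1 lt2; have [qL qD qj _] := essP q qE; have [q'L q'D _ _] := essP q' q'E.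
    have f1N : (q.1.+1 < N)%N by apply: leq_ltn_trans lt2 (ltn_ord _).
    move: qE; rewrite in_setI inE => /andP [/and3P [_ nE _] _].
    case/negP: nE; apply/existsP; exists (Ordinal f1N, q.2); rewrite !eqxx in_D /= !andbT.
    move: (q'D); rewrite in_D => /andP [h1 h2]; apply/andP; split; last first.
      by rewrite e1; apply: leq_ltn_trans h2.
    rewrite ltnNge; apply/negP => h.
    have jf : pi^-1%g (Ordinal f1N) = j0.
      by apply: (unique_dot q'D); [rewrite /dot_le permKV -e1 h andbT | exact: dotL].
    by move: qj; rewrite -jf permKV /= ltnNge leqnSn.
  have card_part (T1 T2 : finType) s : #|@part T1 T2 s| = if s then #|T1| else #|T2|.
    case: s.
      have inj : injective (@inl T1 T2) by move=> x y [].
      rewrite -cardsT -(card_imset _ inj); apply: eq_card => -[x|y]; rewrite !inE /=.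
        by apply/esym/imsetP; exists x.
      by apply/esym/negP => /imsetP [].
    have inj : injective (@inr T1 T2) by move=> x y [].
    rewrite -cardsT -(card_imset _ inj); apply: eq_card => -[x|y]; rewrite !inE /=.
      by apply/esym/negP => /imsetP [].
    by apply/esym/imsetP; exists y.
  case; rewrite card_part card_sig.
  (* The four rows are that of the dot and, strictly below it, the distinct rows of three essential
     boxes. *)
  + pose S := pi j0 |: [set q.1 | q in Ess pi :&: L pi].
    apply: (@leq_trans #|S|).
      have nin : pi j0 \notin [set q.1 | q in Ess pi :&: L pi].
        by apply/negP => /imsetP [q /essP [_ _ h _] e]; rewrite e ltnn in h.
      have inj : {in Ess pi :&: L pi &, injective (fun q : box => q.1)}.
        move=> q q' qE q'E e; case: (ltngtP q.2 q'.2) => h.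
        * by case: (ess_row q q').
        * by case: (ess_row q' q).
        * by move: e (val_inj h); case: (q) (q') => ? ? [? ?] /= -> ->.
      by rewrite /S cardsU1 nin (card_in_imset inj) add1n ltnS.
    apply: subset_leq_card; apply/subsetP => a; rewrite !inE.
    case/orP=> [/eqP ->|/imsetP [q /essP [qL _ _ _] ->]].
      apply/existsP; exists j0; apply: Ldown q0L _ _; rewrite /box_le /dot_le /= ?leqnn //.
      by rewrite (ltnW q01) (ltnW q02).
    by apply/existsP; exists q.2; case: (q) qL.
  + pose S := j0 |: [set q.2 | q in Ess pi :&: L pi].
    apply: (@leq_trans #|S|).
      have nin : j0 \notin [set q.2 | q in Ess pi :&: L pi].
        by apply/negP => /imsetP [q /essP [_ _ _ h] e]; rewrite e ltnn in h.
      have inj : {in Ess pi :&: L pi &, injective (fun q : box => q.2)}.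
        move=> q q' qE q'E e; case: (ltngtP q.1 q'.1) => h.
        * by case: (ess_col q q').
        * by case: (ess_col q' q).
        * by move: e (val_inj h); case: (q) (q') => ? ? [? ?] /= -> ->.
      by rewrite /S cardsU1 nin (card_in_imset inj) add1n ltnS.
    apply: subset_leq_card; apply/subsetP => a; rewrite !inE.
    case/orP=> [/eqP ->|/imsetP [q /essP [qL _ _ _] ->]].
      apply/existsP; exists (pi j0); apply: Ldown q0L _ _; rewrite /box_le /dot_le /= ?leqnn //.
      by rewrite (ltnW q01) (ltnW q02).
    by apply/existsP; exists q.1; case: (q) qL.
Qed.

End UniqueDot.

(** * Polynomial functions *)

Section PolynomialFunctions.
Variable K : numFieldType.

Lemma poly_zero_off0 (p : {poly K}) : (forall s, s != 0 -> p.[s] = 0) -> p = 0.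
Proof.
move=> h; apply/eqP; apply: contraT => p0.
have := max_poly_roots (rs := [seq (i.+1)%:R | i <- iota 0 (size p)]) p0.
rewrite size_map size_iota ltnn => -> //.
  by apply/allP => _ /mapP [i _ ->]; apply/rootP; apply: h; rewrite pnatr_eq0.
rewrite map_inj_uniq ?iota_uniq // => i j /eqP.
by rewrite eqr_nat eqSS => /eqP.
Qed.

Lemma digits_inj B n (f g : 'I_n -> nat) :
    (forall i, (f i < B)%N) -> (forall i, (g i < B)%N) ->
  (\sum_i f i * B ^ i = \sum_i g i * B ^ i)%N -> f =1 g.
Proof.
elim: n f g => [|n IH] f g fB gB; first by move=> _ [].
have red (h : 'I_n.+1 -> nat) :
    (\sum_i h i * B ^ i = (\sum_i h (lift ord0 i) * B ^ i) * B + h ord0)%N.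
  rewrite big_ord_recl /= expn0 muln1 addnC big_distrl /=; congr (_ + _)%N.
  by apply: eq_bigr => i _; rewrite /bump /= add1n expnSr mulnA.
have B0 : (0 < B)%N := leq_ltn_trans (leq0n _) (fB ord0).
rewrite !red => e.
have e0 : f ord0 = g ord0.
  by have := congr1 (modn^~ B) e; rewrite /= !modnMDl !modn_small.
move: e; rewrite e0 => /addIn /eqP; rewrite eqn_pmul2r // => /eqP e.
have eqS : (fun i => f (lift ord0 i)) =1 (fun i => g (lift ord0 i)) by apply: IH.
by move=> i; case: (unliftP ord0 i) => [j ->|->]; [exact: eqS | exact: e0].
Qed.

(* Kronecker's substitution X_i := t ^ (B ^ i) separates the monomials whose
   exponents are less than B. *)
Lemma mpoly_eval0 n (P : {mpoly K[n]}) : (forall v, P.@[v] = 0) -> P = 0.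
Proof.
move=> h; pose B := msize P; pose e (m : 'X_{1..n}) := (\sum_i m i * B ^ i)%N.
pose p := \sum_(m <- msupp P) P@_m *: 'X^(e m) : {poly K}.
have p0 : p = 0.
  apply: poly_zero_off0 => s _; rewrite -[RHS](h (fun i => s ^+ (B ^ i))) mevalE.
  rewrite /p horner_sum; apply: eq_bigr => m _; rewrite hornerZ hornerXn; congr (_ * _).
  by rewrite /e expr_sum; apply: eq_bigr => i _; rewrite mulnC exprM.
apply/mpolyP => m; rewrite mcoeff0.
have [mP|] := boolP (m \in msupp P); last exact: memN_msupp_eq0.
have ltB (m' : 'X_{1..n}) i : m' \in msupp P -> (m' i < B)%N.
  move=> /msize_mdeg_lt; apply: leq_ltn_trans.
  by rewrite mdegE (bigD1 i) //= leq_addr.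
have := congr1 (fun q : {poly K} => q`_(e m)) p0.
rewrite coef0 /p coef_sum (bigD1_seq m) ?msupp_uniq //= coefZ coefXn eqxx mulr1.
rewrite big_seq_cond big1 ?addr0 // => m' /andP [m'P nm].
rewrite coefZ coefXn; case: eqP => [ee|]; last by rewrite mulr0.
case/eqP: nm; apply/mnmP => i.
by apply: (digits_inj (B := B)) => [j|j|] //; [exact: ltB | exact: ltB].
Qed.

Lemma meval_line n (P : {mpoly K[n]}) (w : 'I_n -> K) (b : pred 'I_n) :
  exists f : {poly K}, forall t, f.[t] = P.@[fun i => if b i then t else w i].
Proof.
exists (\sum_(m <- msupp P) P@_m *: \prod_i (if b i then 'X else (w i)%:P) ^+ m i).
move=> t; rewrite mevalE horner_sum; apply: eq_bigr => m _.
rewrite hornerZ horner_prod; congr (_ * _); apply: eq_bigr => i _.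
by rewrite horner_exp; case: (b i); rewrite ?hornerX ?hornerC.
Qed.

End PolynomialFunctions.

(** * Coordinates on the Borel orbit *)

Section OrbitCoordinates.
Variables (K : numFieldType) (N : nat) (pi : 'S_N).
Local Notation box := ('I_N * 'I_N)%type.
Implicit Types (p q : box) (x v : box -> K).

(** A box (i, j) outside D(pi) that is weakly below the dot of its column is the parameter at (i, pi
    j) of this factor; if it is strictly above that dot, it is right of the dot of its row and is
    the parameter at (pi^-1 i, j) of [upper_factor]. *)
Definition lower_factor x : 'M[K]_N :=
  \matrix_(i, l) if (l <= i)%N then x (i, pi^-1%g l) else 0.

Definition upper_factor x : 'M[K]_N :=
  \matrix_(k, j) if k == j then 1
                 else if (k < j)%N && (pi k < pi j)%N then x (pi k, j) else 0.

(* The parameters x are indexed by the boxes outside D(pi). In row-major order each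
   of these entries of the orbit is affine in its own parameter, with coefficient
   1 or an earlier parameter, up to a function of earlier parameters; hence they are
   algebraically independent. *)
Definition orbit_entry x p : K :=
  \sum_k (if (pi k <= p.1)%N then x (p.1, k) else 0) * upper_factor x k p.2.

Definition generic x : Prop := forall j, x (pi j, j) != 0.

Definition row_major p : nat := p.1 * N + p.2.

Definition update x p (s : K) : box -> K := fun q => if q == p then s else x q.

Lemma row_major_lt p : (row_major p < N * N)%N.
Proof.
rewrite /row_major; case: p => a b /=; apply: (@leq_trans (a.+1 * N)).
  by rewrite mulSn addnC ltn_add2r.
by rewrite leq_mul2r ltn_ord orbT.
Qed.

Lemma row_major_ltP p q :
  (row_major p < row_major q)%N = (p.1 < q.1)%N || (p.1 == q.1) && (p.2 < q.2)%N.
Proof.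
rewrite /row_major; case: p q => a b [c d] /=; have := ltn_ord b; have := ltn_ord d.
rewrite -(inj_eq val_inj) /=; case: (ltngtP a c) => h hd hb.
- apply: (@leq_trans (a.+1 * N)); first by rewrite mulSn addnC ltn_add2r.
  by apply: leq_trans (leq_addr _ _); rewrite leq_mul2r h orbT.
- apply/negbTE; rewrite -leqNgt; apply: (@leq_trans (c.+1 * N)).
    by rewrite mulSn addnC leq_add2r ltnW.
  by apply: leq_trans (leq_addr _ _); rewrite leq_mul2r h orbT.
- by rewrite h ltn_add2l.
Qed.

Lemma row_major_inj : injective row_major.
Proof.
move=> [a b] [c d] e; have := row_major_ltP (a, b) (c, d); have := row_major_ltP (c, d) (a, b).
rewrite e ltnn /= => /esym/norP [h1 h2] /esym/norP [h3 h4].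
have eq_ord (i i' : 'I_N) : ~~ (i < i')%N -> ~~ (i' < i)%N -> i = i'.
  by rewrite -!leqNgt => h h'; apply: val_inj; apply/eqP; rewrite eqn_leq h h'.
have ac : a = c by apply: eq_ord.
by move: h2 h4; rewrite ac eqxx /= => h2 h4; congr pair; apply: eq_ord.
Qed.

Lemma orbit_entryP x : generic x -> borel_orbit pi (\matrix_(i, j) orbit_entry x (i, j)).
Proof.
move=> gx; exists (lower_factor x), (upper_factor x).
have bt : is_trig_mx (lower_factor x).
  by apply/is_trig_mxP => i j ij; rewrite mxE leqNgt ij.
have ct : is_trig_mx (upper_factor x)^T.
  apply/is_trig_mxP => i j ij; rewrite !mxE ltnNge (ltnW ij) /=.
  by rewrite -(inj_eq val_inj) /= gtn_eqF.
split=> //.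
- rewrite unitmxE det_trig // unitfE; apply/prodf_neq0 => i _.
  by rewrite mxE leqnn; have := gx (pi^-1%g i); rewrite permKV.
- rewrite unitmxE -det_tr det_trig // unitfE; apply/prodf_neq0 => i _.
  by rewrite !mxE eqxx oner_eq0.
- apply/matrixP => i j; rewrite !mxE; apply: eq_bigr => k _; congr (_ * _).
  rewrite !mxE (bigD1 (pi k)) //= !mxE eqxx mulr1 permK big1 ?addr0 // => l lk.
  by rewrite !mxE eq_sym (negbTE lk) mulr0.
Qed.

Lemma upper_factor_eq x x' (k j : 'I_N) :
    ((k < j)%N -> (pi k < pi j)%N -> x (pi k, j) = x' (pi k, j)) ->
  upper_factor x k j = upper_factor x' k j.
Proof.
move=> h; rewrite !mxE; case: eqP => // _.
by case: (boolP (k < j)%N) h => //= _; case: (boolP (pi k < pi j)%N) => //= _ ->.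
Qed.

Lemma upper_factor_gt x (k j : 'I_N) : (j < k)%N -> upper_factor x k j = 0.
Proof.
move=> jk; rewrite mxE -(inj_eq val_inj) /= gtn_eqF //.
by rewrite ltnNge (ltnW jk).
Qed.

Lemma orbit_entry_local x x' p :
    (forall q, (row_major q <= row_major p)%N -> x q = x' q) ->
  orbit_entry x p = orbit_entry x' p.
Proof.
case: p => i j h; apply: eq_bigr => k _ /=.
case: ifP => [ki|]; last by rewrite !mul0r.
case: (ltngtP k j) => kj; last first.
- rewrite (val_inj kj) !mxE eqxx h //.
- by rewrite !upper_factor_gt // !mulr0.
congr (_ * _); first by apply: h; rewrite ltnW // row_major_ltP /= eqxx kj orbT.
apply: upper_factor_eq => _ _; apply: h; move: ki; rewrite leq_eqVlt => /orP [/eqP e|lt].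
  by rewrite (val_inj e).
by rewrite ltnW // row_major_ltP /= lt.
Qed.

Lemma orbit_entry_affine x p : generic x -> p \notin D pi ->
  exists c r, c != 0 /\ forall s, orbit_entry (update x p s) p = c * s + r.
Proof.
case: p => i j gx; rewrite in_D /= negb_and -!leqNgt => nD.
have upd s q : q != (i, j) -> update x (i, j) s q = x q by rewrite /update => /negbTE ->.
have updp s : update x (i, j) s (i, j) = s by rewrite /update eqxx.
have rest (S : pred 'I_N) : ~~ S j -> (forall k, S k -> (pi k <= i)%N -> (k < j)%N ->
     (pi k < pi j)%N -> pi k != i) -> forall s,
   \sum_(k | S k) (if (pi k <= i)%N then update x (i, j) s (i, k) else 0) *
      upper_factor (update x (i, j) s) k j =
   \sum_(k | S k) (if (pi k <= i)%N then x (i, k) else 0) * upper_factor x k j.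
  move=> Sj hS s; apply: eq_bigr => k Sk; case: ifP => [ki|]; last by rewrite !mul0r.
  have kj : k != j by apply: contraNneq Sj => <-.
  congr (_ * _); first by rewrite upd // xpair_eqE (negbTE kj) andbF.
  apply: upper_factor_eq => lt1 lt2; rewrite upd // xpair_eqE negb_and.
  by rewrite (hS k Sk ki lt1 lt2).
have [ji|ij] := leqP (pi j) i.
- exists 1, (\sum_(k | k != j) (if (pi k <= i)%N then x (i, k) else 0) * upper_factor x k j).
  split=> [|s]; first exact: oner_neq0.
  rewrite /orbit_entry (bigD1 j) //= rest ?eqxx //.
    by rewrite ji updp mxE eqxx mulr1 mul1r.
  move=> k _ _ _ lt; apply/eqP => e; move: lt; rewrite e.
  by rewrite ltnNge ji.
- move: nD; rewrite (leqNgt (pi j)) ij orbF; set k0 := (pi^-1)%g i => k0j'.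
  have pk0 : pi k0 = i by rewrite /k0 permKV.
  have nk0 : k0 != j by apply/eqP => e; move: ij; rewrite -e pk0 ltnn.
  have k0j : (k0 < j)%N by rewrite ltn_neqAle (inj_eq val_inj) nk0 k0j'.
  exists (x (i, k0)), (\sum_(k | (k != k0) && (k != j))
     (if (pi k <= i)%N then x (i, k) else 0) * upper_factor x k j).
  split=> [|s]; first by rewrite -pk0.
  rewrite /orbit_entry (bigD1 k0) //= (bigD1 j) 1?eq_sym //= rest ?eqxx ?andbF //.
    rewrite pk0 leqnn (leqNgt (pi j)) ij mul0r add0r upd ?xpair_eqE ?(negbTE nk0) ?andbF //.
    by rewrite mxE (negbTE nk0) k0j pk0 ij updp.
  move=> k /andP [nk _] _ _ _; apply: contraNneq nk => e.
  by apply/eqP; apply: (@perm_inj _ pi); rewrite pk0.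
Qed.

Lemma update_generic x p s : generic x -> s != 0 -> generic (update x p s).
Proof. by move=> gx s0 j; rewrite /update; case: ifP. Qed.

(** The coordinates are freed one box at a time, from the last in row-major order backwards: in
    [dense], v agrees with an orbit point before position r and is arbitrary from r on. An affine
    entry with nonzero slope takes enough values to be made free. *)
Lemma orbit_dense n (phi : 'I_n -> box) (P : {mpoly K[n]}) : injective phi ->
    (forall i, phi i \notin D pi) ->
    (forall x, generic x -> P.@[fun i => orbit_entry x (phi i)] = 0) -> P = 0.
Proof.
move=> phi_inj phiD h; apply: mpoly_eval0 => w.
have dense m r : (r + m = N * N)%N -> forall x v, generic x ->
    (forall q, q \notin D pi -> (row_major q < r)%N -> v q = orbit_entry x q) ->
    P.@[fun i => v (phi i)] = 0.
  elim: m r => [|m IH] r rm x v gx hv.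
    rewrite -[RHS](h x gx); apply: meval_eq => i; apply: hv => //.
    by rewrite -(addn0 r) rm row_major_lt.
  have {}IH := IH r.+1 _; rewrite addSnnS in IH; have {}IH := IH rm.
  have step : (forall q, row_major q = r -> q \in D pi) -> P.@[fun i => v (phi i)] = 0.
    move=> hq; apply: (IH x v gx) => q qD; rewrite ltnS leq_eqVlt => /orP [/eqP e|]; last exact: hv.
    by rewrite hq in qD.
  have [/existsP [p /eqP pr]|/existsPn np] := boolP [exists p, row_major p == r]; last first.
    by apply: step => q /eqP e; have := np q; rewrite e.
  have [pD|pD] := boolP (p \in D pi).
    by apply: step => q e; rewrite (row_major_inj (etrans e (esym pr))).
  have [f fE] := meval_line P (fun i => v (phi i)) (fun i => phi i == p).
  have [c [b [c0 cE]]] := orbit_entry_affine gx pD.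
  (* The value 0 is avoided because the parameter at a dot must stay nonzero; vanishing for all
     other s already kills the polynomial. *)
  have f0 s : s != 0 -> f.[c * s + b] = 0.
    move=> s0; rewrite fE -cE.
    apply: (IH (update x p s) (update v p (orbit_entry (update x p s) p))).
      exact: update_generic.
    move=> q qD; rewrite ltnS leq_eqVlt => /orP [/eqP e|qr].
      by rewrite (row_major_inj (etrans e (esym pr))) /update eqxx.
    have qp : (q == p) = false by apply/eqP => e; move: qr; rewrite e pr ltnn.
    rewrite [LHS]/update qp hv //; apply: orbit_entry_local => q' q'q.
    rewrite /update; case: eqP => // e; move: q'q; rewrite e pr.
    by rewrite leqNgt qr.
  have g0 : f \Po (c *: 'X + b%:P) = 0.
    by apply: poly_zero_off0 => s s0; rewrite horner_comp !hornerE f0.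
  have := congr1 (fun g : {poly K} => g.[c^-1 * (v p - b)]) g0.
  have tE : (c *: 'X + b%:P).[c^-1 * (v p - b)] = v p.
    by rewrite hornerD hornerZ hornerX hornerC mulVKf // subrK.
  rewrite /= horner0 horner_comp tE fE => <-.
  by apply: meval_eq => i; case: eqP => [->|].
pose v q := if [pick i | phi i == q] is Some i then w i else 0.
have -> : P.@[w] = P.@[fun i => v (phi i)].
  apply: meval_eq => i; rewrite /v; case: pickP => [j /eqP /phi_inj -> //|/(_ i)].
  by rewrite eqxx.
by apply: (dense (N * N)%N 0%N _ (fun=> 1)) => // j; exact: oner_neq0.
Qed.

Definition coord p : {mpoly K[N * N]} := 'X_(mxvec_index p.1 p.2).

Lemma coord_alg_indep n (phi : 'I_n -> box) : injective phi ->
    (forall i, phi i \in L pi :\: D pi) ->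
  alg_indep_on (Y_var pi) (fun i => coord (phi i)).
Proof.
move=> phi_inj phiL P h; apply: (orbit_dense phi_inj) => [i|x gx].
  by have := phiL i; rewrite in_setD => /andP [].
rewrite -[RHS](h (proj_L pi (\matrix_(i, j) orbit_entry x (i, j)))).
  apply: meval_eq => i; rewrite /peval /coord mevalXU mxvecE !mxE.
  by have := phiL i; rewrite in_setD -surjective_pairing => /andP [_ ->].
exists (\matrix_(i, j) orbit_entry x (i, j)) => // f; apply; exact: orbit_entryP.
Qed.

Lemma card_le_variety_dim d : variety_dim (@Y_var K N pi) d -> (#|L pi :\: D pi| <= d)%N.
Proof.
move=> [_ h]; rewrite leqNgt; apply/negP => lt.
apply: (h (fun i => coord (enum_val (widen_ord lt i)))); apply: coord_alg_indep.
  move=> i j /enum_val_inj /(congr1 val) /= e; exact: val_inj.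
by move=> i; apply: enum_valP.
Qed.

End OrbitCoordinates.

(** * The torus action *)

Section Torus.
Variables (K : numFieldType) (N : nat) (pi : 'S_N).
Local Notation box := ('I_N * 'I_N)%type.
Implicit Types (p q : box).

Lemma clear_denominators n (u : 'I_n -> rat) :
  exists (m : int) (w : 'I_n -> int), m != 0 /\ forall i, (w i)%:~R = m%:~R * u i.
Proof.
exists (\prod_i denq (u i)), (fun i => numq (u i) * \prod_(j | j != i) denq (u j)).
split=> [|i]; first by apply/prodf_neq0 => i _; exact: denq_neq0.
by rewrite [in RHS](bigD1 i) //= !intrM numqE; ring.
Qed.

Lemma two_exprz_eq1 (z : int) : (2 : K) ^ z = 1 -> z = 0.
Proof.
have pow n : (2 : K) ^+ n = 1 -> n = 0%N.
  move=> /eqP; rewrite -natrX pnatr_eq1 => /eqP e; case: n e => // n.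
  by rewrite expnS; lia.
case: z => n /=; first by rewrite -exprnP => /pow ->.
by rewrite NegzE -exprnN => /eqP; rewrite invr_eq1 => /eqP /pow.
Qed.

Lemma exprz_prod n (y : 'I_n -> K) (z : int) : (\prod_i y i) ^ z = \prod_i y i ^ z.
Proof.
by apply: (big_morph (fun y => y ^ z)) => [a b|]; [exact: expfzMl | exact: exp1rz].
Qed.

Lemma exprz_sum n (y : K) (z : 'I_n -> int) : y != 0 -> y ^ (\sum_i z i) = \prod_i y ^ z i.
Proof.
move=> y0; apply: (big_morph (fun z => y ^ z)) => [m l|]; last exact: expr0z.
exact: expfzDr.
Qed.

(** An integral relation w between the columns of W makes the product of the powers y_k^(w_k) equal
    to 1 on the image, hence for every y in the torus. Testing with 2 in one place and 1 elsewhere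
    gives w = 0. *)
Lemma surjective_monomial_rank n d (W : 'M[int]_(n, d)) :
    (forall y : 'rV[K]_d, in_torus y -> exists2 t, in_torus t & monomial_map W t = y) ->
  \rank (map_mx (intr : int -> rat) W) = d.
Proof.
move=> surj; rewrite -mxrank_tr; apply/eqP; apply: inj_row_free => v v0.
have [m [w [m0 wE]]] := clear_denominators (v 0).
have Ww i : \sum_k W i k * w k = 0.
  apply: (@intr_inj rat).
  transitivity (m%:~R * (v *m (map_mx (intr : int -> rat) W)^T) 0 i); last first.
    by rewrite v0 mxE mulr0.
  rewrite mxE mulr_sumr rmorph_sum /=; apply: eq_bigr => k _.
  by rewrite !mxE rmorphM /= wE mulrC mulrA.
apply/rowP => k0; rewrite mxE.
suff w0 : w k0 = 0.
  have := wE k0; rewrite w0 => /esym /eqP; rewrite mulf_eq0 intr_eq0 (negbTE m0).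
  by move/eqP.
apply: two_exprz_eq1.
pose y : 'rV[K]_d := \row_k (if k == k0 then 2 else 1).
have [|t t0 tE] := surj y.
  by move=> k; rewrite mxE; case: ifP; rewrite ?oner_eq0 ?pnatr_eq0.
have -> : (2 : K) ^ w k0 = \prod_k y 0 k ^ w k.
  rewrite (bigD1 k0) //= mxE eqxx big1 ?mulr1 // => k /negbTE nk.
  by rewrite mxE nk exp1rz.
rewrite -tE (eq_bigr (fun k => \prod_i t 0 i ^ (W i k * w k))) => [|k _]; last first.
  by rewrite mxE exprz_prod; apply: eq_bigr => i _; rewrite exprz_exp.
rewrite exchange_big /= big1 // => i _.
by rewrite -exprz_sum // Ww expr0z.
Qed.

Lemma torus_act_fixes (t : 'rV[K]_(N + N)) (M : 'M[K]_N) : in_torus t ->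
    (forall a b, M a b != 0 -> t 0 (lshift N a) = t 0 (rshift N b)) ->
  torus_act t M = M.
Proof.
move=> t0 tE; rewrite /torus_act.
have unit : diag_mx (rsubmx t) \in unitmx.
  by rewrite unitmxE det_diag unitfE; apply/prodf_neq0 => i _; rewrite mxE.
suff -> : diag_mx (lsubmx t) *m M = M *m diag_mx (rsubmx t) by rewrite mulmxK.
apply/matrixP => a b; rewrite mul_diag_mx mul_mx_diag !mxE.
have [->|nz] := eqVneq (M a b) 0; first by rewrite mulr0 mul0r.
by rewrite (tE a b nz) mulrC.
Qed.

Lemma hook_in_LD j p q : q \in D pi -> box_le p q -> dot_le pi j p ->
  (p.1 == pi j) || (p.2 == j) -> p \in L pi :\: D pi.
Proof.
move=> qD pq jp hook; rewrite in_setD; apply/andP; split.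
  apply/negP => pD; have [h1 h2] := D_strict_dot pD jp.
  by case/orP: hook => /eqP e; [move: h1 | move: h2]; rewrite e ltnn.
apply/in_L; split; last by exists j.
by apply/in_NW; exists q.
Qed.

Definition incidence_row p : 'rV[rat]_(N + N) :=
  delta_mx 0 (lshift N p.1) - delta_mx 0 (rshift N p.2).

Definition incidence : 'M[rat]_(#|L pi :\: D pi|, N + N) :=
  \matrix_(r < #|L pi :\: D pi|) incidence_row (enum_val r).

(** A kernel vector of the incidence matrix, scaled to integers w, gives the torus point with
    coordinates 2^(w_i). It acts trivially on Y, so W sends it to 1 and w is in the kernel of W; the
    inclusion of kernels bounds the rank. *)
Lemma acting_torus_dim_le d : acting_torus_dim (@Y_var K N pi) d -> (d <= \rank incidence)%N.
Proof.
move=> [W [surj ker]]; set Wq := map_mx (intr : int -> rat) W.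
have rW : \rank Wq = d by exact: surjective_monomial_rank surj.
suff sub : (kermx incidence^T <= kermx Wq)%MS.
  have := mxrankS sub; rewrite !mxrank_ker mxrank_tr rW.
  have := rank_leq_row Wq; have := rank_leq_col incidence; rewrite rW; lia.
apply/rV_subP => u /sub_kermxP u0; apply/sub_kermxP.
have [m [w [m0 wE]]] := clear_denominators (u 0).
have wLD p : p \in L pi :\: D pi -> w (lshift N p.1) = w (rshift N p.2).
  move=> pLD; apply: (@intr_inj rat); rewrite !wE; congr (_ * _); apply/eqP.
  rewrite -subr_eq0; apply/eqP.
  have := congr1 (fun A : 'rV[rat]_ _ => A 0 (enum_rank_in pLD p)) u0.
  rewrite !mxE => <-; rewrite (bigD1 (lshift N p.1)) //= (bigD1 (rshift N p.2)) ?eq_rlshift //=.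
  rewrite !mxE !enum_rankK_in // !eqxx eq_lrshift eq_rlshift /= big1.
    by rewrite subr0 sub0r mulr1 mulrN1 addr0.
  move=> i /andP [/negbTE h1 /negbTE h2].
  by rewrite !mxE enum_rankK_in // h1 h2 andbF subrr mulr0.
(* Equality passes from the boxes outside D(pi) to all of L(pi) along (a, j), (pi j, j), (pi j, b),
   which lie in the row or column of a dot and thus outside D(pi). *)
have wL a b : (a, b) \in L pi -> w (lshift N a) = w (rshift N b).
  move=> /in_L [/in_NW [q qD /andP [/= aq bq]] [j /andP [/= ja jb]]].
  have := @wLD (a, j); have := @wLD (pi j, j); have := @wLD (pi j, b).
  rewrite /= => h1 h2 h3; rewrite h3 -?h2 ?h1 //; apply: (@hook_in_LD j _ q) => //=;
    by rewrite /box_le /dot_le /= ?eqxx ?orbT ?leqnn ?aq ?bq ?ja ?jb // ?(leq_trans ja) ?(leq_trans jb).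
pose t : 'rV[K]_(N + N) := \row_i 2 ^ w i.
have t0 : in_torus t by move=> i; rewrite mxE expfz_neq0 // pnatr_eq0.
have tW : monomial_map W t = const_mx 1.
  apply/(ker t t0) => _ [M _ ->]; apply: torus_act_fixes => // a b.
  by rewrite !mxE; case: ifP => [/wL ->|]; rewrite ?eqxx.
apply/rowP => k; rewrite [RHS]mxE; apply: (mulfI (_ : m%:~R != 0 :> rat)); first by rewrite intr_eq0.
rewrite mulr0; suff <- : ((\sum_i w i * W i k)%:~R : rat) = m%:~R * (u *m Wq) 0 k.
  rewrite (_ : \sum_i _ = 0) //; apply: two_exprz_eq1.
  transitivity (monomial_map W t 0 k); last by rewrite tW mxE.
  by rewrite mxE exprz_sum ?pnatr_eq0 //; apply: eq_bigr => i _; rewrite mxE exprz_exp.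
rewrite mxE mulr_sumr rmorph_sum; apply: eq_bigr => i _.
by rewrite !mxE rmorphM /= wE mulrA.
Qed.

(* Two dots p = (c,d) and p' = (c',d') north-west of a box (e,f) of D(pi) give the
   6-cycle c - f - c' - d' - e - d - c in the graph of L(pi) \ D(pi), so that the
   incidence rows are dependent. *)
Lemma toric_unique_dot d q j k : acting_torus_dim (@Y_var K N pi) d ->
  variety_dim (@Y_var K N pi) d -> q \in D pi -> dot_le pi j q -> dot_le pi k q -> j = k.
Proof.
move=> td vd qD jq kq; apply/eqP; apply: contraT => jk.
have free : row_free incidence.
  rewrite /row_free eqn_leq rank_leq_row.
  exact: leq_trans (card_le_variety_dim vd) (acting_torus_dim_le td).
have [j1 j2] := D_strict_dot qD jq; have [k1 k2] := D_strict_dot qD kq.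
have hook l p : dot_le pi l q -> box_le p q -> dot_le pi l p ->
    (p.1 == pi l) || (p.2 == l) -> p \in L pi :\: D pi.
  by move=> _; exact: hook_in_LD qD.
have le l : dot_le pi l q -> [/\ (pi l, q.2) \in L pi :\: D pi,
    (pi l, l) \in L pi :\: D pi & (q.1, l) \in L pi :\: D pi].
  move=> lq; have /andP [l1 l2] := lq.
  by split; apply: (hook l) => //=; rewrite /box_le /dot_le /= ?l1 ?l2 ?leqnn ?eqxx ?orbT.
have [m1 m2 m3] := le j jq; have [n1 n2 n3] := le k kq.
pose e p (pL : p \in L pi :\: D pi) : 'rV[rat]_ _ := delta_mx 0 (enum_rank_in pL p).
have eE p (pL : p \in L pi :\: D pi) : e p pL *m incidence = incidence_row p.
  by rewrite /e -rowE rowK enum_rankK_in.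
pose g := e _ m1 - e _ n1 + e _ n2 - e _ n3 + e _ m3 - e _ m2.
have g0 : g = 0.
  apply/eqP; rewrite -(mulmx_free_eq0 g free); apply/eqP.
  rewrite /g !(mulmxDl, mulNmx) !eE /incidence_row /=.
  apply/rowP => i; rewrite !mxE; ring.
pose r := enum_rank_in m1 (pi j, q.2).
have eV p (pL : p \in L pi :\: D pi) : p != (pi j, q.2) -> (e p pL) 0 r = 0.
  move=> np; rewrite mxE /= (_ : _ == _ = false) //; apply/eqP => /(congr1 enum_val).
  by rewrite !enum_rankK_in // => h; rewrite h eqxx in np.
have gr : g 0 r = e _ m1 0 r - e _ n1 0 r + e _ n2 0 r - e _ n3 0 r + e _ m3 0 r - e _ m2 0 r.
  by rewrite !mxE.
have nkj : pi k != pi j by apply: contra jk => /eqP /perm_inj ->.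
have neq_lt (a b : 'I_N) : (a < b)%N -> (a != b) && (b != a).
  by move=> h; rewrite -!(inj_eq val_inj) /= neq_ltn h /= eq_sym neq_ltn h.
have /andP [_ q1j] := neq_lt _ _ j1; have /andP [jq2 _] := neq_lt _ _ j2.
move: gr; rewrite g0 (eV _ n1) ?(eV _ n2) ?(eV _ n3) ?(eV _ m3) ?(eV _ m2);
  try by rewrite xpair_eqE negb_and ?nkj ?q1j ?jq2 ?orbT.
by rewrite !mxE !eqxx !(subr0, addr0) => /eqP; rewrite eq_sym oner_eq0.
Qed.

End Torus.

Local Close Scope ring_scope.

Theorem proposition4p11 (R : realType) (N : nat) (pi : {perm 'I_N})
    (toric_pi : toric R pi)
    (L_connected : box_connected (L pi))
    (three_ess : 3 <= #|Ess pi :&: L pi|)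
    (simplicial3 : forall F, face (edge_cone (@Gpi N pi)) F ->
       cone_dim F 3 -> simplicial F) :
  [/\ forall I : {set {set Grow pi + Gcol pi}},
        pairwise_face_triple (@Gpi N pi) I ->
        ~ forms_face (@Gpi N pi) 3 I ->
        exists s : bool,
          (exists i i' i'' : Grow pi + Gcol pi,
             [/\ i \in part s, i' \in part s, i'' \in part s
               & I = [set part s :\ i; part s :\ i'; part s :\ i'']]) \/
          (exists (i i' : Grow pi + Gcol pi) (C : {set Grow pi + Gcol pi}),
             [/\ i \in part s, i' \in part s, two_sided C
               & I = [set part s :\ i; part s :\ i'; C]]),
      forall (s : bool) (i i' i'' : Grow pi + Gcol pi),
        i \in part s -> i' \in part s -> i'' \in part s ->
        let I := [set part s :\ i; part s :\ i'; part s :\ i''] in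
        pairwise_face_triple (@Gpi N pi) I ->
        (~ forms_face (@Gpi N pi) 3 I <->
         exists C : {set Grow pi + Gcol pi},
           [/\ C \in first_independent (@Gpi N pi), two_sided C
             & C :&: part s = part s :\: [set i; i'; i'']])
    & forall (s : bool) (i i' : Grow pi + Gcol pi)
             (C : {set Grow pi + Gcol pi}),
        i \in part s -> i' \in part s -> two_sided C ->
        let I := [set part s :\ i; part s :\ i'; C] in
        pairwise_face_triple (@Gpi N pi) I ->
        (~ forms_face (@Gpi N pi) 3 I <->
         C :&: part s = [set i; i'] \/
         exists C' : {set Grow pi + Gcol pi},
           [/\ C' \in first_independent (@Gpi N pi), two_sided C',
               C' :&: part s \subset C :&: part s
             & (C :&: part s) :\: (C' :&: part s) = [set i; i']])].
Proof.
have [d td vd] := toric_pi.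
have fE : ferrers (@Gpi N pi).
  by apply: ferrers_Gpi => // q j k; exact: toric_unique_dot td vd.
split=> [I|s i i' i''|s i i' C]; first exact: not_face_form.
  exact: one_sided_triple.
exact: mixed_triple.
Qed.
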